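(* Consider the completely random measure mixed Poisson model with mass $\gamma_0=G_0(\Omega)$ and jump measure $\rho$ described in the context, with random sample size $n$ and cluster labels $\boldsymbol z=(z_1,\ldots,z_n)$. Then: (1) The joint distribution of $(\boldsymbol z,n)$ (exchangeable cluster probability function) is $$p(\boldsymbol z,n\mid\gamma_0,\rho)=\frac{\gamma_0^l}{n!}\exp\left\{\gamma_0\int_0^\infty(e^{-s}-1)\rho(ds)\right\}\prod_{k=1}^l\int_0^\infty s^{n_k}e^{-s}\rho(ds),$$ where $l$ is the number of clusters in $\boldsymbol z$ and $n_k=\sum_{i=1}^n\mathbf 1(z_i=k)$. (2) The marginal distribution of the sample size $n=X(\Omega)$ has probability generating function $$\mathbb{E}[t^n\mid\gamma_0,\rho]=\exp\left\{\gamma_0\int_0^\infty(e^{-(1-t)s}-1)\rho(ds)\right\}$$ and probability mass function $$p_N(n\mid\gamma_0,\rho)=\frac{1}{n!}\left.\frac{d^n}{dt^n}\mathbb{E}[t^{N}\mid\gamma_0,\rho]\right|_{t=0},$$ where $N$ denotes the random sample size. (3) The conditional distribution of $\boldsymbol z$ given the sample size $n$ (exchangeable partition probability function of the partition $\Pi_n$ of $\{1,\ldots,n\}$) is $$p(\boldsymbol z\mid n,\gamma_0,\rho)=\frac{p(\boldsymbol z,n\mid\gamma_0,\rho)}{p_N(n\mid\gamma_0,\rho)}.$$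
   Context: Setting: $\Omega$ is a complete separable metric space, $G_0$ a finite measure on $\Omega$ with $\gamma_0=G_0(\Omega)>0$, and $\rho$ a nonzero measure on $(0,\infty)$ with $\int_0^\infty(1-e^{-s})\rho(ds)<\infty$. $G=\sum_k r_k\delta_{\omega_k}$ is the completely random measure whose points $(r_k,\omega_k)$ are those of a Poisson random measure on $(0,\infty)\times\Omega$ with intensity $\rho(ds)G_0(d\omega)$. Given $G$, the sample size satisfies $n\sim\mathrm{Po}(G(\Omega))$, and given $G$ and $n$, each of the $n$ elements is independently assigned to atom $\omega_k$ with probability $r_k/G(\Omega)$; equivalently the counts at the atoms are independent $\mathrm{Po}(r_k)$, giving the mixed Poisson process $X=\sum_k n_k\delta_{\omega_k}$ with $n=X(\Omega)$. Elements assigned to the same atom form a cluster, which defines a random partition $\Pi_n$ of $\{1,\ldots,n\}$. Clusters are relabelled $1,\ldots,l$ in order of appearance, so $\boldsymbol z=(z_1,\ldots,z_n)$ with $z_i\in\{1,\ldots,l\}$ encodes $\Pi_n$ ($z_i$ is the label of the cluster of element $i$); $n_k$ is the size of cluster $k$. $p(\boldsymbol z,n\mid\gamma_0,\rho)$ is the probability, with $G$ integrated out, that the sample size is $n$ and the label sequence is $\boldsymbol z$ (for $n=0$, $l=0$ and $\boldsymbol z$ is empty). *)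

(* Defs.v *)
From HB Require Import structures.
From mathcomp Require Import all_boot all_order all_algebra.
From mathcomp Require Import all_classical all_reals all_analysis.
From mathcomp Require Import measurable_realfun.

Set Implicit Arguments.
Unset Strict Implicit.
Unset Printing Implicit Defensive.

Import Order.TTheory GRing.Theory Num.Theory.
Import numFieldNormedType.Exports.

Local Open Scope classical_set_scope.
Local Open Scope ring_scope.
Local Open Scope ereal_scope.

#[short(type="completeMetricType")]
HB.structure Definition CompleteMetric (K : numDomainType) :=
  {T of Metric K T & Complete T}.

Definition separable_space (T : topologicalType) : Prop :=
  exists2 S : set T, countable S & dense S.

Notation borel_space T := (g_sigma_algebraType (@open T)).

Section poisson_random_measure.
Context (R : realType) (d : measure_display) (T : measurableType d)
  (P : probability T R).

(* [poisson_prob] does not depend on its second argument; it is the Dirac mass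
   at 0 when the rate is 0. *)
Definition poisson_law (rate : R) (n : nat) : \bar R :=
  poisson_prob rate 0 [set n].

Definition poisson_count (X : T -> \bar R) (lambda : \bar R) : Prop :=
  (lambda = +oo -> P [set w | X w = +oo] = 1) /\
  (lambda < +oo ->
     forall n : nat, P [set w | X w = n%:R%:E] = poisson_law (fine lambda) n).

Definition mutually_independent (m : nat) (X : 'I_m -> T -> \bar R) : Prop :=
  forall B : 'I_m -> set (\bar R), (forall i, measurable (B i)) ->
    P [set w | forall i, B i (X i w)] = \prod_(i < m) P (X i @^-1` B i).

Definition poisson_random_measure (d' : measure_display)
    (E : measurableType d') (intensity : set E -> \bar R)
    (M : T -> set E -> \bar R) : Prop :=
  [/\ forall A, measurable A -> measurable_fun [set: T] (M ^~ A),
      forall A, measurable A -> poisson_count (M ^~ A) (intensity A) &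
      forall (m : nat) (A : 'I_m -> set E), (forall i, measurable (A i)) ->
        trivIset [set: 'I_m] A ->
        mutually_independent (fun i w => M w (A i))].

End poisson_random_measure.

Section conditioning.
Context (R : realType) (d : measure_display) (T : measurableType d)
  (P : probability T R).

(* [f] is a version of the conditional probability of [A] given the
   sigma-algebra [S]. *)
Definition is_cond_prob (S : set (set T)) (A : set T) (f : T -> \bar R) : Prop :=
  (forall B, measurable B -> S (f @^-1` B)) /\
  (forall E, S E -> P (A `&` E) = \int[P]_(w in E) f w).

Definition event_cond_prob (A B : set T) : \bar R := P (A `&` B) / P B.

End conditioning.

Section model.
Context (R : realType) (Omega : completeMetricType R)
  (d : measure_display) (T : measurableType d) (P : probability T R).

(* The points (r_k, omega_k) of the Poisson random measure are enumerated by
   k : nat.  There may be only finitely many of them: a term of the enumeration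
   with r_k = 0 stands for no point at all.  Elements and atoms are numbered
   from 0; [alloc i] is the index k of the atom to which element i is assigned,
   and is relevant only when i < [size_N].  Two elements are in the same cluster
   when they have the same index k, so that coinciding locations (possible when
   [G0] has atoms) do not merge clusters. *)
Variables (jump : nat -> {RV P >-> R}) (atom : nat -> {RV P >-> borel_space Omega})
  (size_N : {RV P >-> nat}) (alloc : nat -> {RV P >-> nat}).

Definition point_process (w : T) (A : set (R * borel_space Omega)) : \bar R :=
  \sum_(k <oo) \d_(jump k w, atom k w) (A `&` (`]0%R, +oo[ `*` [set: Omega])).

Definition crm (w : T) (B : set (borel_space Omega)) : \bar R :=
  \sum_(k <oo) (jump k w)%:E * \d_(atom k w) B.

Definition crm_mass (w : T) : R := fine (crm w [set: Omega]).

Definition atom_count (w : T) (k : nat) : nat :=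
  count (fun i => alloc i w == k) (iota 0 (size_N w)).

Definition mixed_poisson_process (w : T) (B : set (borel_space Omega)) : \bar R :=
  \sum_(k <oo) (atom_count w k)%:R%:E * \d_(atom k w) B.

Definition sigma_points : set (set T) :=
  <<s (\bigcup_k (preimage_set_system setT (jump k) measurable `|`
                  preimage_set_system setT (atom k) measurable)) >>.

Definition sigma_points_size : set (set T) :=
  <<s (sigma_points `|` preimage_set_system setT size_N measurable) >>.

(* A measure on ]0, +oo[ is rendered as a measure [rho] on R; the model is meant
   for [rho] vanishing on ]-oo, 0], in agreement with [point_process], which only
   counts points of ]0, +oo[ * Omega.  Since [crm_mass] is 0 where the total mass
   is infinite, the two conditional laws below are the expected ones almost
   surely; when the mass is 0 the sample is empty. *)
Record crm_mixed_poisson_model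
    (G0 : {finite_measure set (borel_space Omega) -> \bar R})
    (rho : {measure set R -> \bar R}) : Prop := {
  jump_ge0 : forall k w, (0 <= jump k w)%R ;
  points_poisson : poisson_random_measure P (rho \x G0) point_process ;
  size_given_points : forall n : nat,
    is_cond_prob P sigma_points [set w | size_N w = n]
      (fun w => poisson_law (crm_mass w) n) ;
  alloc_given_points_size : forall (n : nat) (kappa : 'I_n -> nat),
    is_cond_prob P sigma_points_size
      [set w | size_N w = n /\ forall i : 'I_n, alloc i w = kappa i]
      (fun w => if size_N w == n
                then (\prod_(i < n) (jump (kappa i) w / crm_mass w))%R%:E
                else 0)
}.

(* Each entry is replaced by the rank, counted from 1, of its value in the order
   of first appearance. *)
Definition labels (s : seq nat) : seq nat :=
  [seq size (undup (take (index x s).+1 s)) | x <- s].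

Definition num_clusters (z : seq nat) : nat := size (undup z).

Definition label_event (n : nat) (z : seq nat) : set T :=
  [set w | labels [seq alloc i w | i <- iota 0 n] = z].

Definition size_event (n : nat) : set T := [set w | size_N w = n].

Definition joint_prob (z : seq nat) (n : nat) : \bar R :=
  P (label_event n z `&` size_event n).

Definition size_pmf (n : nat) : \bar R := P (size_event n).

Definition cond_label_prob (z : seq nat) (n : nat) : \bar R :=
  event_cond_prob P (label_event n z) (size_event n).

Definition size_pgf (t : R) : \bar R := 'E_P[(fun w => (t ^+ size_N w)%R)].

End model.

(* Main.v *)
(* Approximating a nonnegative f by simple functions, the independence and the
   Poisson laws of the counts give the Laplace functional
     E exp(- sum_k f(r_k)) = exp(- gamma0 * int (1 - e^{-f}) drho),
   whence the total mass is almost surely finite.  Differentiating it in the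
   directions s^b, b > 0, at f + t s^b, t -> 0+, gives by induction on l the
   multivariate Palm formula for
     E[e^{-sum_k r_k} sum_{k_1, ..., k_l distinct} r_{k_1}^{n_1} ... r_{k_l}^{n_l}]:
   a derivative multiplies the sum over distinct tuples by sum_k r_k^b, that is,
   either appends a new index to the tuple or increases one of the exponents,
   and the latter terms are known by induction.  Conditioning on G turns the
   probability of a label sequence into 1/n! times that expectation, since the
   label sequence only tells which elements share an atom.  The generating
   function of the size is E exp(- (1 - t) G(Omega)), and its derivatives at 0
   are those of the power series of the masses of N. *)

Require Import Defs.
From HB Require Import structures.
From mathcomp Require Import all_boot all_order all_algebra.
From mathcomp Require Import all_classical all_reals all_analysis.
From mathcomp Require Import measurable_realfun.
From mathcomp Require Import ring lra.

Import Order.TTheory GRing.Theory Num.Theory.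
Import numFieldNormedType.Exports.
Import HBNNSimple.

Local Open Scope classical_set_scope.
Local Open Scope ring_scope.
Local Open Scope ereal_scope.

Set Implicit Arguments.
Unset Strict Implicit.
Unset Printing Implicit Defensive.

(** The obstacle to differentiating under the integral by domination is that the next sum over
    distinct indices is not known to be integrable before its formula is proved. Difference
    quotients are therefore taken only along the steps h = 2^-n: (1 - e^{-h x}) / h increases to x
    as h is halved, so monotone convergence gives a limit in [0, +oo], whose finiteness is read off
    from the other side of the identity. Identities are accordingly written additively between
    nonnegative, possibly infinite terms, and cancellation is kept for finite quantities. The
    formula is wanted at g(s) = s only, but its quotient in the direction s^b calls it at s + 2^-n
    s^b; hence the induction runs over a class [admissible] closed under such perturbations and
    bounded below by s, so that e^{-g} outweighs every power of s. Almost sure finiteness of the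
    total mass M is needed before the conditional laws can be exploited: where M is infinite,
    [crm_mass] is 0, whereas e^{-M} has to vanish there. *)

Lemma monotone_cvg_integral d (T : measurableType d) (R : realType)
    (mu : {measure set T -> \bar R}) (f_ : nat -> T -> \bar R) (f : T -> \bar R) :
  (forall n, measurable_fun setT (f_ n)) ->
  (forall n x, 0 <= f_ n x) ->
  (forall x, {homo f_ ^~ x : n m / (n <= m)%N >-> n <= m}) ->
  (forall x, f_ n x @[n --> \oo] --> f x) ->
  \int[mu]_x f_ n x @[n --> \oo] --> \int[mu]_x f x.
Proof.
move=> mf f0 ndf fE.
have -> : f = fun x => limn (f_ ^~ x).
  by apply/funext => x; apply/esym/cvg_lim => //; exact: fE.
exact: cvg_monotone_convergence.
Qed.

(** Both sides integrate [phi] against a measure on [T3], the image under [X] or [Y] of a measure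
    with density [V] or [W]; agreement on sets extends to simple functions, then to monotone limits.
    It serves twice: to extend independence from events to functions, and to extend a conditional
    probability from events to measurable weights. *)
Lemma integral_transfer d1 d2 d3 (T1 : measurableType d1)
    (T2 : measurableType d2) (T3 : measurableType d3) (R : realType)
    (P : {measure set T1 -> \bar R}) (Q : {measure set T2 -> \bar R})
    (X : T1 -> T3) (Y : T2 -> T3) (V : T1 -> R) (W : T2 -> R) :
  measurable_fun setT X -> measurable_fun setT Y ->
  measurable_fun setT V -> measurable_fun setT W ->
  (forall x, 0 <= V x)%R -> (forall y, 0 <= W y)%R ->
  (forall B, measurable B ->
    \int[P]_x (\1_B (X x) * V x)%:E = \int[Q]_y (\1_B (Y y) * W y)%:E) ->
  forall phi : T3 -> R, measurable_fun setT phi -> (forall z, 0 <= phi z)%R ->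
    \int[P]_x (phi (X x) * V x)%:E = \int[Q]_y (phi (Y y) * W y)%:E.
Proof.
move=> mX mY mV mW V0 W0 XYE phi mphi phi0.
have m1 B d (T : measurableType d) (Z : T -> T3) : measurable B ->
    measurable_fun setT Z -> measurable_fun setT (fun x => \1_B (Z x) : R).
  by move=> mB mZ; apply: measurableT_comp => //.
have simple (h : {nnsfun T3 >-> R}) :
    \int[P]_x (h (X x) * V x)%:E = \int[Q]_y (h (Y y) * W y)%:E.
  have hE d (T : measurableType d) (mu : {measure set T -> \bar R}) (Z : T -> T3)
      (U : T -> R) : measurable_fun setT Z -> measurable_fun setT U ->
      (forall x, 0 <= U x)%R ->
      \int[mu]_x (h (Z x) * U x)%:E =
      \sum_(y \in range h) y%:E * \int[mu]_x (\1_(h @^-1` [set y]) (Z x) * U x)%:E.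
    move=> mZ mU U0.
    have mf y : measurable_fun setT
        (fun x => (\1_(h @^-1` [set y]) (Z x) * U x)%:E).
      apply/measurable_EFinP/measurable_funM => //; exact: m1.
    (* The maximum with 0 changes nothing on the range of [h], but makes the terms nonnegative for
       every real [y], as the exchange of sum and integral asks. *)
    transitivity (\int[mu]_x \sum_(y \in range h)
        ((Num.max 0 y)%:E * (\1_(h @^-1` [set y]) (Z x) * U x)%:E)).
      apply: eq_integral => x _; rewrite fimfunE.
      rewrite EFinM -fsumEFin// ge0_mule_fsuml; last first.
        move=> y; rewrite lee_fin indicE.
        case: (boolP (_ \in _)) => [|_]; last by rewrite mulr0.
        by rewrite inE/= => <-; rewrite mulr1.
      apply: eq_fsbigr => y /[!inE]-[z _ <-].
      by rewrite -!EFinM mulrA (max_idPr _).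
    rewrite ge0_integral_fsum//.
    - apply: eq_fsbigr => y /[!inE]-[z _ <-].
      rewrite ge0_integralZl_EFin//.
      + by rewrite (max_idPr _).
      + by move=> x _; rewrite lee_fin mulr_ge0.
      + by rewrite le_max lexx.
    - by move=> y; apply: emeasurable_funM.
    - move=> y x _; rewrite mule_ge0// lee_fin ?le_max ?lexx//.
      by rewrite mulr_ge0.
  rewrite !hE//; apply: eq_fsbigr => y _; rewrite XYE//.
have mphi' : measurable_fun setT (EFin \o phi) by apply/measurable_EFinP.
have [g [ndg gphi]] := approximation measurableT mphi' (fun z _ => phi0 z).
have cvgU d (T : measurableType d) (mu : {measure set T -> \bar R}) (Z : T -> T3)
    (U : T -> R) : measurable_fun setT Z -> measurable_fun setT U ->
    (forall x, 0 <= U x)%R ->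
    \int[mu]_x (g n (Z x) * U x)%:E @[n --> \oo] -->
    \int[mu]_x (phi (Z x) * U x)%:E.
  move=> mZ mU U0; apply: monotone_cvg_integral.
  - move=> n; apply/measurable_EFinP/measurable_funM => //.
    exact: measurableT_comp.
  - by move=> n x; rewrite lee_fin mulr_ge0.
  - move=> x n m nm; rewrite lee_fin ler_wpM2r//.
    by have /lefP := ndg _ _ nm.
  - move=> x; under eq_fun do rewrite EFinM.
    by rewrite EFinM; apply: cvgeZr => //; exact: gphi.
have := cvgU _ _ P X V mX mV V0.
under eq_fun do rewrite simple.
move=> /(cvg_lim (@ereal_hausdorff R)) <-.
by apply: cvg_lim => //; exact: cvgU.
Qed.

Lemma expectation_prod_independent d (T : measurableType d) (R : realType)
    (P : probability T R) (m : nat) (X : 'I_m -> T -> \bar R)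
    (phi : 'I_m -> \bar R -> R) :
  (forall i, measurable_fun setT (X i)) -> mutually_independent P X ->
  (forall i, measurable_fun setT (phi i)) -> (forall i x, 0 <= phi i x <= 1)%R ->
  \int[P]_w (\prod_(i < m) phi i (X i w))%:E =
  \prod_(i < m) \int[P]_w (phi i (X i w))%:E.
Proof.
move=> mX indX.
(* Factors are freed one at a time: those of index at least [j] are still indicators. At [j = 0] the
   claim is independence itself, at [j = m] the factors are arbitrary. *)
pose indic j (psi : 'I_m -> \bar R -> R) := forall i : 'I_m, (j <= i)%N ->
  exists2 B, measurable B & psi i = \1_B.
suff H j : forall psi : 'I_m -> \bar R -> R, (forall i, measurable_fun setT (psi i)) ->
    (forall i x, 0 <= psi i x <= 1)%R -> indic j psi ->
    \int[P]_w (\prod_(i < m) psi i (X i w))%:E =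
    \prod_(i < m) \int[P]_w (psi i (X i w))%:E.
  by move=> mphi phi01; apply: (H m) => // i; rewrite leqNgt ltn_ord.
elim: j => [psi mpsi psi01 ipsi|j IH psi mpsi psi01 ipsi].
  have /choice[B BE] : forall i, exists B, measurable B /\ psi i = \1_B.
    by move=> i; have [B mB ->] := ipsi i (leq0n i); exists B.
  under [RHS]eq_bigr => i _.
    rewrite (eq_integral (fun w => (\1_(X i @^-1` B i) w)%:E)); last first.
      by move=> w _; rewrite (BE i).2.
    rewrite integral_indic// ?setIT; last first.
      by rewrite -[X in measurable X]setTI; apply: mX => //; exact: (BE i).1.
    over.
  rewrite -indX; last by move=> i; exact: (BE i).1.
  have -> : P [set w | forall i, B i (X i w)] =
      \int[P]_w (\1_[set w | forall i, B i (X i w)] w)%:E.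
    rewrite integral_indic// ?setIT//.
    rewrite (_ : mkset _ = \bigcap_(i in [set: 'I_m]) (X i @^-1` B i)).
      apply: fin_bigcap_measurable => // i _.
      by rewrite -[X in measurable X]setTI; apply: mX => //; exact: (BE i).1.
    by apply/seteqP; split=> w /= H i; [move=> _|]; exact: H.
  apply: eq_integral => w _; congr EFin.
  rewrite indicE; case: (boolP (w \in _)) => [|].
    rewrite inE /= => H; rewrite big1// => i _; rewrite (BE i).2 indicE mem_set//.
  rewrite notin_setE/= => /existsNP[i Bi].
  by rewrite (bigD1 i)//= (BE i).2 indicE memNset ?mul0r.
have [mj|jm] := leqP m j.
  by apply: IH => // i ji; have := leq_trans mj ji; rewrite leqNgt ltn_ord.
pose j0 := Ordinal jm.
have mpart : measurable_fun setT (fun w => \prod_(i < m | i != j0) psi i (X i w))%R.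
  under eq_fun do rewrite -big_filter.
  apply: (@measurable_prod _ _ _ _ _ _ (fun i w => psi i (X i w))) => i _.
  exact: measurableT_comp.
have part0 w : (0 <= \prod_(i < m | i != j0) psi i (X i w))%R.
  by apply: prodr_ge0 => i _; case/andP: (psi01 i (X i w)).
have int01 i : 0 <= \int[P]_w (psi i (X i w))%:E <= 1.
  rewrite integral_ge0/=; last by move=> w _; rewrite lee_fin; case/andP: (psi01 i (X i w)).
  rewrite (@le_trans _ _ (\int[P]_w (cst 1 w)))//.
    apply: ge0_le_integral => //.
    - by move=> w _; rewrite lee_fin; case/andP: (psi01 i (X i w)).
    - by apply/measurable_EFinP; exact: measurableT_comp.
    - by move=> w _; rewrite lee_fin; case/andP: (psi01 i (X i w)).
  by rewrite integral_cst// mul1e probability_le1.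
pose c := \prod_(i < m | i != j0) \int[P]_w (psi i (X i w))%:E.
have c0 : 0 <= c by apply: prode_ge0 => i _; case/andP: (int01 i).
have cfin : c \is a fin_num.
  apply: prode_fin_num => i _; have /andP[i0 i1] := int01 i.
  by rewrite ge0_fin_numE// (le_lt_trans i1)// ltry.
have constE (f : T -> R) : measurable_fun setT f -> (forall w, 0 <= f w)%R ->
    \int[P]_w (f w * fine c)%:E = \int[P]_w (f w)%:E * c.
  move=> mf f0; under eq_integral do rewrite EFinM muleC.
  rewrite ge0_integralZl_EFin//.
  - by rewrite fineK// muleC.
  - by move=> w _; rewrite lee_fin.
  - exact/measurable_EFinP.
  - exact: fine_ge0.
rewrite (bigD1 j0)//= -/c -constE//; last 2 first.
- exact: measurableT_comp.
- by move=> w; case/andP: (psi01 j0 (X j0 w)).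
under eq_integral do rewrite (bigD1 j0)//=.
(* The factor at [j0] is transferred from indicators to [psi j0]. On the left the weight is the
   product of the other factors; on the right it is the constant [fine c], the product of their
   expectations. *)
apply: (@integral_transfer _ _ _ T T _ _ _ _ (X j0) (X j0) _ (cst (fine c))) => //.
- by move=> w; exact: fine_ge0.
- move=> B mB; pose psi' i := if i == j0 then \1_B else psi i.
  rewrite constE//; last by apply: measurableT_comp.
  have := IH psi'; rewrite (bigD1 j0)//= /psi' eqxx.
  under [X in _ * X]eq_bigr => i /negPf -> do [].
  rewrite -/c => <-.
  - apply: eq_integral => w _; rewrite [in RHS](bigD1 j0)//= eqxx.
    congr (_ * _)%:E.
    by apply: eq_bigr => i /negPf ->.
  - by move=> i; case: ifP.
  - move=> i x; case: ifP => // _; rewrite indicE.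
    by case: (_ \in _); rewrite lexx ler01.
  - move=> i; case: ifP => [_ _|/negbT ij ji]; first by exists B.
    apply: ipsi; rewrite ltn_neqAle ji andbT; apply: contra ij => /eqP ji'.
    by apply/eqP/val_inj.
- by move=> z; case/andP: (psi01 j0 z).
Qed.

(** * Laplace transform of Poisson counts *)

Lemma nneseries_exp_coeff (R : realType) (x : R) : (0 <= x)%R ->
  \sum_(0 <= n <oo) (x ^+ n / n`!%:R)%:E = (expR x)%:E.
Proof.
move=> x0; rewrite /expR -EFin_lim; last exact: is_cvg_series_exp_coeff.
by apply/congr_lim/funext => n /=; rewrite /series/= -sumEFin.
Qed.

Lemma poisson_lawE (R : realType) (r : R) n : (0 <= r)%R ->
  poisson_law r n = (r ^+ n / n`!%:R * expR (- r))%:E.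
Proof.
rewrite le_eqVlt => /predU1P[<-|r0]; rewrite /poisson_law /poisson_prob.
  rewrite ltxx diracE; case: n => [|n].
    by rewrite mem_set//= expr0 fact0 invr1 mulr1 oppr0 expR0 mulr1.
  by rewrite memNset//= expr0n/= !mul0r.
by rewrite r0 esum_set1 /poisson_pmf r0// lee_fin !mulr_ge0 ?invr_ge0 ?exprn_ge0
  ?expR_ge0// ltW.
Qed.

(* [expR (- x)] for [x] in [0, +oo], with values in [0, 1] on the whole of
   [\bar R]. *)
Definition expN (R : realType) (x : \bar R) : R :=
  if x == +oo then 0%R else expR (- `|fine x|).

Lemma expN_itv (R : realType) (x : \bar R) : (0 <= expN x <= 1)%R.
Proof.
rewrite /expN; case: ifP => _; first by rewrite lexx ler01.
by rewrite expR_ge0 -[leRHS](@expR0 R) ler_expR oppr_le0 normr_ge0.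
Qed.

Lemma expN_ge0 (R : realType) (x : \bar R) : (0 <= expN x)%R.
Proof. by case/andP: (expN_itv x). Qed.

Lemma expNE (R : realType) (x : \bar R) : 0 <= x -> (expN x)%:E = expeR (- x).
Proof.
by case: x => [r||]//=; rewrite ?lee_fin /expN//= => r0; rewrite ger0_norm.
Qed.

Lemma expN_fin (R : realType) (x : R) : (0 <= x)%R -> expN x%:E = expR (- x).
Proof. by move=> x0; apply: EFin_inj; rewrite expNE. Qed.

Lemma expND (R : realType) (x y : \bar R) : 0 <= x -> 0 <= y ->
  (expN (x + y) = expN x * expN y)%R.
Proof.
case: x y => [x||] [y||]// x0 y0; last 3 first.
- by rewrite /expN eqxx mulr0.
- by rewrite /expN eqxx mul0r.
- by rewrite /expN eqxx mul0r.
by rewrite -EFinD !expN_fin ?addr_ge0// opprD expRD.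
Qed.

Lemma measurable_expN (R : realType) : measurable_fun setT (@expN R).
Proof.
apply: measurable_fun_ifT => //.
- exact: measurable_fun_eqe.
- apply: measurableT_comp => //; apply: measurableT_comp => //.
  by apply: measurableT_comp => //; exact: fine_measurable.
Qed.

Lemma measurable_expN_comp d (T : measurableType d) (R : realType)
    (f : T -> \bar R) : measurable_fun setT f ->
  measurable_fun setT (fun x => expN (f x)).
Proof. exact: (measurableT_comp (@measurable_expN R)). Qed.

Lemma le_expN (R : realType) (x y : \bar R) : 0 <= x -> x <= y ->
  (expN y <= expN x)%R.
Proof.
move=> x0 xy; rewrite -lee_fin !expNE ?(le_trans x0)//.
by rewrite lee_expeR leeN2.
Qed.

Lemma cvg_expN (R : realType) (u : nat -> \bar R) (l : \bar R) :
  (forall n, 0 <= u n) -> u n @[n --> \oo] --> l ->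
  expN (u n) @[n --> \oo] --> expN l.
Proof.
move=> u0 ul; have l0 : 0 <= l.
  have <- := cvg_lim (@ereal_hausdorff R) ul.
  by apply: lime_ge; [by apply/cvg_ex; exists l|exact: nearW].
case: l l0 ul => [l||]// l0 ul.
  move: (ul) => /fine_cvgP[ufin /= ul'].
  rewrite expN_fin//.
  have : expR (- fine (u n))%R @[n --> \oo] --> expR (- l).
    by apply: continuous_cvg; [exact: continuous_expR|exact: cvgN].
  apply: cvg_trans; apply: near_eq_cvg; near=> n.
  have fn : u n \is a fin_num by near: n.
  by rewrite -[in RHS](fineK fn) expN_fin// fine_ge0.
rewrite {2}/expN eqxx; apply/cvgrPdist_le => e e0.
move/cvgeyPge : ul => /(_ (Num.max 0 (- ln e))%R).
apply: filterS => n un; rewrite sub0r normrN ger0_norm ?expN_ge0//.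
apply: (@le_trans _ _ (expN (Num.max 0 (- ln e))%:E)).
  by apply: le_expN => //; rewrite lee_fin le_max lexx.
rewrite expN_fin ?le_max ?lexx// -[leRHS]lnK// ler_expR.
by rewrite lerNl le_max lexx orbT.
Unshelve. all: by end_near. Qed.

Section poisson_count_theory.
Context d (T : measurableType d) (R : realType) (P : probability T R).

(** The case [a = 0] stands apart because [0 * +oo = 0]. For [a > 0] an infinite rate makes both
    sides 0, and a finite one reduces the claim to the exponential series at r e^{-a}. *)
Lemma poisson_count_laplace (X : T -> \bar R) (lambda : \bar R) (a : R) :
  measurable_fun setT X -> (forall w, 0 <= X w) -> 0 <= lambda ->
  (0 <= a)%R -> poisson_count P X lambda ->
  \int[P]_w (expN (a%:E * X w))%:E = (expN (lambda * (1 - expR (- a))%:E))%:E.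
Proof.
move=> mX X0 lambda0; rewrite le_eqVlt => /predU1P[<- _|a0 [PX PXf]].
  rewrite oppr0 expR0 subrr mule0 expN_fin// oppr0 expR0.
  under eq_integral do rewrite mul0e expN_fin// oppr0 expR0.
  by rewrite integral_cst//= mul1e probability_setT.
have ea1 : (0 < 1 - expR (- a))%R.
  by rewrite subr_gt0 -[ltRHS](@expR0 R) ltr_expR oppr_lt0.
have mlevel y : measurable [set w | X w = y].
  by rewrite -[X in measurable X]setTI; exact: (mX measurableT _ (emeasurable_set1 y)).
have mphi : measurable_fun setT (fun w => (expN (a%:E * X w))%:E).
  apply/measurable_EFinP/measurable_expN_comp; exact: measurable_funeM.
have [loo|] := eqVneq lambda +oo.
  have -> : (expN (lambda * (1 - expR (- a))%:E))%:E = 0 :> \bar R.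
    by rewrite loo gt0_mulye// /expN eqxx.
  apply/eqP; rewrite eq_le; apply/andP; split; last first.
    by apply: integral_ge0 => w _; rewrite lee_fin expN_ge0.
  have P0 : P (~` [set w | X w = +oo]) = 0.
    by rewrite probability_setC// PX// subee.
  have <- : \int[P]_w (\1_(~` [set w | X w = +oo%E]) w : R)%:E = 0.
    by rewrite integral_indic ?setIT ?P0//; exact: measurableC.
  apply: ge0_le_integral => //.
  - by move=> w _; rewrite lee_fin expN_ge0.
  - by apply/measurable_EFinP/measurable_indic; exact: measurableC.
  - move=> w _; rewrite lee_fin indicE; case: (boolP (w \in _)).
      by case/andP: (expN_itv (a%:E * X w)).
    by rewrite notin_setE/= => /contrapT ->; rewrite gt0_muley// /expN eqxx.
rewrite -ltey => lfin; have lr : lambda = (fine lambda)%:E.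
  by rewrite fineK// ge0_fin_numE.
have r0 : (0 <= fine lambda)%R by exact: fine_ge0.
set r := fine lambda in lr r0.
pose E n := [set w | X w = n%:R%:E].
have mE n : measurable (E n) by exact: mlevel.
have tE : trivIset setT E.
  apply/trivIsetP => i j _ _ ij; apply/seteqP; split => // w [].
  rewrite /E/= => -> [] /eqP.
  by rewrite eqr_nat (negPf ij).
have PE n : P (E n) = (r ^+ n / n`!%:R * expR (- r))%:E.
  by rewrite (PXf lfin) poisson_lawE.
have mU : measurable (\bigcup_n E n) by exact: bigcupT_measurable.
(* The Poisson masses sum to 1, so the count is almost surely a natural number and the integral can
   be cut along the level sets [E n]. *)
have PU : P (\bigcup_n E n) = 1.
  rewrite measure_bigcup//= (eq_eseriesl (Q := xpredT)); last first.
    by move=> n; rewrite in_setT.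
  under eq_eseriesr do rewrite PE mulrC EFinM.
  rewrite nneseriesZl//; last by move=> n _; rewrite lee_fin divr_ge0// exprn_ge0.
  by rewrite nneseries_exp_coeff// -EFinM mulrC expRxMexpNx_1.
rewrite -(@setUv _ (\bigcup_n E n)) ge0_integral_setU//; last 4 first.
- exact: measurableC.
- by rewrite setUv.
- by move=> w _; rewrite lee_fin expN_ge0.
- by apply/disj_set2P; rewrite setICr.
rewrite [X in _ + X]null_set_integral ?adde0//; last 3 first.
- exact: measurableC.
- exact: measurable_funTS.
- by have := probability_setC P mU; rewrite PU subee.
rewrite ge0_integral_bigcup//; last 2 first.
- exact: measurable_funTS.
- by move=> w _; rewrite lee_fin expN_ge0.
rewrite lr -EFinM expN_fin; last by rewrite mulr_ge0// ltW.
transitivity (\sum_(0 <= n <oo)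
    ((expR (- r))%:E * ((r * expR (- a)) ^+ n / n`!%:R)%:E)).
  apply: eq_eseriesr => n _.
  rewrite (eq_integral (cst (expN (a%:E * n%:R%:E))%:E)); last first.
    by move=> w; rewrite inE => ->.
  rewrite integral_cst//= PE -EFinM expN_fin ?mulr_ge0 ?(ltW a0)// -!EFinM.
  congr EFin.
  rewrite exprMn -expRM_natr mulNr.
  by ring.
rewrite nneseriesZl ?lee_fin ?expR_ge0//; last first.
  by move=> n _; rewrite lee_fin divr_ge0// exprn_ge0// mulr_ge0// expR_ge0.
rewrite nneseries_exp_coeff ?mulr_ge0 ?expR_ge0// -EFinM -expRD; congr (expR _)%:E.
by rewrite mulrBr mulr1 opprB addrC.
Qed.

End poisson_count_theory.

(** * Dyadic difference quotients of the exponential *)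

Lemma cvg_exprV2 (R : realType) : (2 ^- n : R)%R @[n --> \oo] --> 0%R.
Proof.
have /cvg_geometric : (`|2^-1 : R| < 1)%R.
  by rewrite ger0_norm ?invr_ge0// invf_lt1// ltr1n.
move=> /(_ 1%R); apply: cvg_trans; apply: near_eq_cvg.
by apply: nearW => n; rewrite /geometric/= mul1r exprVn.
Qed.

(** Minus the difference quotient at 0 of t |-> e^{-t x}, with step 2^-n. Dyadic steps reduce
    monotonicity in [n] to one halving. *)
Definition expN_quot (R : realType) (n : nat) (x : \bar R) : R :=
  (2 ^+ n * (1 - expN ((2 ^- n)%:E * x)))%R.

Section expN_quot_theory.
Context (R : realType).

Lemma expN_quot_ge0 n (x : \bar R) : (0 <= expN_quot n x)%R.
Proof.
by rewrite mulr_ge0 ?exprn_ge0// subr_ge0; case/andP: (expN_itv ((2 ^- n)%:E * x)).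
Qed.

Lemma measurable_expN_quot n : measurable_fun setT (@expN_quot R n).
Proof.
apply: measurable_funM => //; apply: measurable_funB => //.
by apply: measurable_expN_comp; exact: measurable_funeM.
Qed.

(** With z = e^{-x / 2^{n+1}} one step is 1 - z^2 <= 2 (1 - z), that is, (1 - z)^2 >= 0. *)
Lemma expN_quot_homo (x : \bar R) : 0 <= x ->
  {homo (fun n => expN_quot n x) : n m / (n <= m)%N >-> (n <= m)%R}.
Proof.
move=> x0; apply/nondecreasing_seqP => n; rewrite /expN_quot.
have y0 : 0 <= (2 ^- n.+1)%:E * x by rewrite mule_ge0// lee_fin invr_ge0 exprn_ge0.
have -> : (2 ^- n)%:E * x = (2 ^- n.+1)%:E * x + (2 ^- n.+1)%:E * x.
  rewrite -ge0_muleDl ?lee_fin ?invr_ge0 ?exprn_ge0//.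
  by congr (_ * _); rewrite -EFinD; congr EFin; rewrite exprS; field; rewrite expf_neq0.
rewrite expND//; have /andP[] := expN_itv ((2 ^- n.+1)%:E * x).
move: (expN _) => z z0 z1; rewrite exprS mulrC [leRHS]mulrAC.
rewrite mulrC [leRHS]mulrC ler_wpM2l ?exprn_ge0//.
by nra.
Qed.

Lemma expN_quot_cvg (x : \bar R) : 0 <= x -> (expN_quot n x)%:E @[n --> \oo] --> x.
Proof.
have e2 := @cvg_exprV2 R.
case: x => [x||]//; rewrite ?lee_fin => x0; last first.
  apply/cvgeyPge => A.
  have := nbhs_infty_ger A; apply: filterS => n An; rewrite /expN_quot.
  rewrite gt0_muley ?lte_fin ?invr_gt0 ?exprn_gt0// /expN eqxx subr0 mulr1.
  by rewrite lee_fin (le_trans An)// -natrX ler_nat ltnW// ltn_expl.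
apply/cvg_EFin; first exact: nearW.
have q n : (expN_quot n x%:E = 2 ^+ n * (1 - expR (- (2 ^- n * x))))%R.
  by rewrite /expN_quot -EFinM expN_fin// mulr_ge0// invr_ge0 exprn_ge0.
(* For y = 2^-n x, the inequalities 1 + y <= e^y and 1 - y <= e^{-y} give y e^{-y} <= 1 - e^{-y} <=
   y. *)
apply: (@squeeze_cvgr _ _ _ _ (fun n => x * expR (- (2 ^- n * x)))%R (cst x)).
- apply: nearW => n /=; rewrite q; set y := (2 ^- n * x)%R.
  have -> : x = (2 ^+ n * y)%R by rewrite mulrA divff ?mul1r// expf_neq0.
  rewrite -mulrA; apply/andP; split; apply: ler_wpM2l; rewrite ?exprn_ge0//.
    have /(ler_wpM2r (expR_ge0 (- y))) := expR_ge1Dx y.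
    by rewrite expRxMexpNx_1 mulrDl mul1r; lra.
  by have := expR_ge1Dx (- y); lra.
- have y0 : (- (2 ^- n * x))%R @[n --> \oo] --> (- (0 * x))%R.
    by apply: cvgN; exact: cvgMl.
  have := cvg_comp _ _ y0 (@continuous_expR R _).
  rewrite mul0r oppr0 expR0 => e1.
  by rewrite -[X in _ --> X]mulr1; exact: cvgMr.
- exact: cvg_cst.
Qed.

Lemma expN_quot_le n (x : R) : (0 <= x)%R -> (expN_quot n x%:E <= x)%R.
Proof.
move=> x0; rewrite /expN_quot -EFinM expN_fin ?mulr_ge0 ?invr_ge0 ?exprn_ge0//.
rewrite mulrC -ler_pdivlMr ?exprn_gt0// mulrC.
by have := expR_ge1Dx (- (x / 2 ^+ n)); lra.
Qed.

Lemma cvg_integral_expN_quot d (T : measurableType d)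
    (mu : {measure set T -> \bar R}) (W H : T -> \bar R) :
  measurable_fun setT W -> measurable_fun setT H ->
  (forall x, 0 <= W x) -> (forall x, 0 <= H x) ->
  \int[mu]_x (W x * (expN_quot n (H x))%:E) @[n --> \oo] -->
  \int[mu]_x (W x * H x).
Proof.
move=> mW mH W0 H0; apply: monotone_cvg_integral.
- move=> n; apply: emeasurable_funM => //; apply/measurable_EFinP.
  exact: (measurableT_comp (measurable_expN_quot n)).
- by move=> n x; rewrite mule_ge0// lee_fin expN_quot_ge0.
- by move=> x n m nm; rewrite lee_wpmul2l// lee_fin expN_quot_homo.
(* Zeros of [W] and [H] are set apart because the product on the extended reals is not continuous at
   (0, +oo). *)
- move=> x; have [W00|W00] := eqVneq (W x) 0.
    by rewrite W00; under eq_fun do rewrite mul0e; rewrite mul0e; exact: cvg_cst.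
  have [H00|H00] := eqVneq (H x) 0.
    under eq_fun do rewrite H00 /expN_quot mule0 expN_fin// oppr0 expR0 subrr mulr0 mule0.
    by rewrite H00 mule0; exact: cvg_cst.
  apply: cvgeM; [|exact: cvg_cst|exact: expN_quot_cvg].
  by rewrite mule_defE !negb_or !negb_and W00 H00.
Qed.

End expN_quot_theory.

(** * Sums over distinct indices *)

Lemma ge0_nneseriesZl (R : realType) (f : nat -> \bar R) (P : pred nat)
    (c : \bar R) : (forall k, 0 <= f k) -> 0 <= c ->
  \sum_(0 <= k <oo | P k) (c * f k) = c * \sum_(0 <= k <oo | P k) f k.
Proof.
move=> f0; case: c => [c||]// c0; first by rewrite nneseriesZl.
(* Here [c = +oo], a case that arises because the power sums of the jumps may be infinite. One
   nonzero term makes both sides infinite; otherwise both are 0. *)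
have [[k Pk fk]|nf] := pselect (exists2 k, P k & f k != 0).
  have fk0 : 0 < f k by rewrite lt_def fk f0.
  rewrite [LHS](nneseries_pinfty (k := k))//; last 2 first.
  - by move=> n _; rewrite mule_ge0.
  - exact: gt0_mulye.
  rewrite gt0_mulye// (lt_le_trans fk0)// (nneseriesD1 (n := k))// leeDl//.
  exact: nneseries_ge0.
have fz k : P k -> f k = 0.
  by move=> Pk; apply/eqP/negPn/negP => fk; apply: nf; exists k.
rewrite [X in _ = _ * X]eseries0 ?mule0; last by move=> k _; exact: fz.
by rewrite eseries0// => k _ Pk; rewrite fz// mule0.
Qed.

Lemma nneseries_sum_cond (R : realType) (I : Type) (s : seq I) (P : pred nat)
    (f : I -> nat -> \bar R) : (forall i k, 0 <= f i k) ->
  \sum_(0 <= k <oo | P k) \sum_(i <- s) f i k =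
  \sum_(i <- s) \sum_(0 <= k <oo | P k) f i k.
Proof.
move=> f0; elim: s => [|i s IH].
  by rewrite big_nil eseries0// => k _ _; rewrite big_nil.
rewrite big_cons -IH -nneseriesD//; last by move=> k _ _; exact: sume_ge0.
by apply: eq_eseriesr => k _; rewrite big_cons.
Qed.

Lemma nneseries_notin (R : realType) (f : nat -> \bar R) (u : seq nat) :
  (forall k, 0 <= f k) -> uniq u ->
  \sum_(0 <= k <oo) f k = \sum_(k <- u) f k + \sum_(0 <= k <oo | k \notin u) f k.
Proof.
move=> f0; elim: u => [_|j u IH /= /andP[ju uu]].
  by rewrite big_nil add0e; apply: eq_eseriesl => k; rewrite in_nil.
rewrite IH// big_cons (nneseriesD1 (n := j))// addeCA -addeA; congr (_ + (_ + _)).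
by apply: eq_eseriesl => k; rewrite in_cons negb_or andbC.
Qed.

Section distinct_sum.
Context (R : realType).

(* The sum of [r k_1 ^+ a_1 * ... * r k_l ^+ a_l] over all [k_1, ..., k_l] that
   are pairwise distinct and not in [u], where [es = [:: a_1; ...; a_l]]. *)
Fixpoint distinct_sum (r : nat -> R) (es u : seq nat) : \bar R :=
  if es is a :: bs then
    \sum_(0 <= k <oo | k \notin u) ((r k ^+ a)%:E * distinct_sum r bs (rcons u k))
  else 1.

(** These lists record the coincidences: an additional index of exponent [b] that equals the one at
    some position raises the exponent there by [b]. *)
Fixpoint incr_each (b : nat) (es : seq nat) : seq (seq nat) :=
  if es is a :: bs then ((a + b)%N :: bs) :: [seq a :: cs | cs <- incr_each b bs]
  else [::].

Variable r : nat -> R.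
Hypothesis r0 : forall k, (0 <= r k)%R.

Lemma distinct_sum_ge0 es u : 0 <= distinct_sum r es u.
Proof.
elim: es u => [|a es IH] u /=; first exact: lee01.
by apply: nneseries_ge0 => k _ _; rewrite mule_ge0// lee_fin exprn_ge0.
Qed.

(** The free index of the power sum is new, equals an index of the tuple, or lies in [u]. The last
    possibility disappears for empty [u], but the recursion of [distinct_sum] moves each chosen
    index into the excluded list, so the induction needs it. *)
Lemma power_sum_distinct_sum b es u : uniq u ->
  (\sum_(0 <= k <oo) (r k ^+ b)%:E) * distinct_sum r es u =
  distinct_sum r (rcons es b) u +
  \sum_(cs <- incr_each b es) distinct_sum r cs u +
  (\sum_(k <- u) (r k ^+ b)%:E) * distinct_sum r es u.
Proof.
have rb0 k : 0 <= (r k ^+ b)%:E by rewrite lee_fin exprn_ge0.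
elim: es u => [|a es IH] u uu.
  rewrite /= big_nil adde0 !mule1 (nneseries_notin _ uu)// addeC.
  by under [in RHS]eq_eseriesr do rewrite mule1.
have H0 : 0 <= \sum_(0 <= k <oo) (r k ^+ b)%:E by apply: nneseries_ge0.
have U0 : 0 <= \sum_(k <- u) (r k ^+ b)%:E by exact: sume_ge0.
have d0 cs v : 0 <= distinct_sum r cs v by exact: distinct_sum_ge0.
have t0 c cs v k : 0 <= (r k ^+ c)%:E * distinct_sum r cs v.
  by rewrite mule_ge0// lee_fin exprn_ge0.
rewrite [distinct_sum r (rcons _ _) u]/= [distinct_sum r (a :: es) u]/=.
rewrite -!ge0_nneseriesZl// [incr_each _ _]/= big_cons big_map.
rewrite [distinct_sum r ((a + b)%N :: es) u]/=.
under [X in _ + (_ + X) + _]eq_bigr do rewrite /=.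
rewrite -nneseries_sum_cond//.
rewrite -!nneseriesD//; last 4 first.
- by move=> k _ _; rewrite adde_ge0// adde_ge0// sume_ge0.
- by move=> k _ _; rewrite mule_ge0.
- by move=> k _ _; rewrite adde_ge0// sume_ge0.
- by move=> k _ _; rewrite sume_ge0.
apply: eq_eseriesr => k ku.
have uk : uniq (rcons u k) by rewrite rcons_uniq ku.
(* The induction hypothesis excludes [rcons u k]. In its last sum, the entry [k] combines with
   [r k ^+ a] into the exponent [a + b], the head of [incr_each]; the entries of [u] keep their
   role. *)
rewrite muleCA IH// -[in X in _ * (_ + X)]cats1 big_cat big_seq1/=.
rewrite (ge0_muleDl _ U0)// ge0_muleDr ?adde_ge0 ?sume_ge0 ?mule_ge0//.
rewrite ge0_muleDr ?sume_ge0// ge0_muleDr ?mule_ge0//.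
rewrite ge0_sume_distrr// muleCA cats1 exprD EFinM -!muleA -!addeA.
by congr (_ + _); rewrite [RHS]addeCA; congr (_ + _); rewrite addeC.
Qed.

End distinct_sum.

(** * Differentiation rules along dyadic steps *)

Section difference_quotient.
Context (R : realType).
Implicit Types (u v : nat -> R) (l m : R).

(* [l'] is the derivative at [0] of a function [f] with [f 0 = l] and
   [f (2 ^- n) = u n], up to sign. *)
Definition has_quot_limit u l l' :=
  (2 ^+ n * (l - u n))%R @[n --> \oo] --> (l' : R).

Lemma has_quot_limit_cvg u l l' : has_quot_limit u l l' ->
  u n @[n --> \oo] --> l.
Proof.
move=> ul; have e2 : (2 ^- n : R)%R @[n --> \oo] --> 0%R by exact: cvg_exprV2.
have : (l - 2 ^- n * (2 ^+ n * (l - u n)))%R @[n --> \oo] --> (l - 0 * l')%R.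
  by apply: cvgB; [exact: cvg_cst|exact: cvgM].
rewrite mul0r subr0; apply: cvg_trans; apply: near_eq_cvg; apply: nearW => n.
by rewrite mulrA mulVf ?expf_neq0// mul1r; lra.
Qed.

Lemma has_quot_limitM u v l m l' m' :
  has_quot_limit u l l' -> has_quot_limit v m m' ->
  has_quot_limit (fun n => u n * v n)%R (l * m)%R (l' * m + l * m')%R.
Proof.
move=> ul vm; have ul0 := has_quot_limit_cvg ul.
have : (2 ^+ n * (l - u n) * m + u n * (2 ^+ n * (m - v n)))%R @[n --> \oo]
    --> (l' * m + l * m')%R.
  apply: cvgD; first exact: cvgMl.
  exact: cvgM.
apply: cvg_trans; apply: near_eq_cvg; apply: nearW => n.
by rewrite -!mulrA [(u n * _)%R]mulrCA -mulrDr; congr *%R; ring.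
Qed.

Lemma has_quot_limitZ c u l l' : has_quot_limit u l l' ->
  has_quot_limit (fun n => c * u n)%R (c * l)%R (c * l')%R.
Proof.
rewrite /has_quot_limit => ul; under eq_fun do rewrite -mulrBr mulrCA.
exact: cvgMr.
Qed.

Lemma has_quot_limitZN c u l l' :
  has_quot_limit (fun n => - u n)%R (- l)%R l' ->
  has_quot_limit (fun n => - (c * u n))%R (- (c * l))%R (c * l')%R.
Proof.
move=> /(@has_quot_limitZ c); rewrite mulrN.
rewrite (_ : (fun n => c * - u n)%R = (fun n => - (c * u n))%R)//.
by apply/funext => n; rewrite mulrN.
Qed.

(** The tangent inequality e^x (y - x) <= e^y - e^x, used at both ends, squeezes the quotient of the
    exponential between two multiples of the quotient of [u]. *)
Lemma has_quot_limit_expR u l l' : has_quot_limit u l l' ->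
  has_quot_limit (fun n => expR (u n)) (expR l) (expR l * l')%R.
Proof.
move=> ul; have ul0 := has_quot_limit_cvg ul.
apply: (@squeeze_cvgr _ _ _ _ (fun n => expR (u n) * (2 ^+ n * (l - u n)))%R
  (fun n => expR l * (2 ^+ n * (l - u n)))%R).
- have tangent x y : (expR x * (y - x) <= expR y - expR x :> R)%R.
    have -> : expR y = (expR x * expR (y - x))%R.
      by rewrite -expRD addrC subrK.
    have := ler_wpM2l (expR_ge0 x) (expR_ge1Dx (y - x)); lra.
  apply: nearW => n; rewrite !(mulrCA (expR _)) !ler_wpM2l ?exprn_ge0//.
  by have := tangent l (u n); lra.
- by apply: cvgM => //; apply: continuous_cvg => //; exact: continuous_expR.
- exact: cvgMr.
Qed.

(** Leibniz rule: differentiating the factor of exponent [a] turns it into the one of exponent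
    [a + b], which is how [incr_each] arises on the analytic side. *)
Lemma has_quot_limit_prod (x : nat -> nat -> R) (y : nat -> R) b es :
  (forall a, (0 < a)%N -> has_quot_limit (x a) (y a) (y (a + b)%N)) ->
  all (leq 1) es ->
  has_quot_limit (fun n => \prod_(a <- es) x a n)%R (\prod_(a <- es) y a)%R
    (\sum_(cs <- incr_each b es) \prod_(a <- cs) y a)%R.
Proof.
move=> xy; elim: es => [_|a es IH /= /andP[a0 es0]].
  rewrite (_ : (fun n => _) = cst 1%R); last by apply/funext => n; rewrite big_nil.
  rewrite !big_nil /has_quot_limit/=; under eq_fun do rewrite subrr mulr0.
  exact: cvg_cst.
rewrite (_ : (fun n => _) = (fun n => x a n * \prod_(i <- es) x i n)%R); last first.
  by apply/funext => n; rewrite big_cons.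
rewrite !big_cons big_map (eq_bigr (fun cs => y a * \prod_(i <- cs) y i)%R).
  by rewrite -mulr_sumr; apply: has_quot_limitM (xy _ a0) (IH es0).
by move=> cs _; rewrite big_cons.
Qed.

(** The exponential brings down [y b], which amounts to appending [b] to the list. The two groups of
    terms match those of [power_sum_distinct_sum] with nothing excluded. *)
Lemma has_quot_limit_weight (u : nat -> R) (l : R) (x : nat -> nat -> R)
    (y : nat -> R) b es :
  has_quot_limit u l (y b) ->
  (forall a, (0 < a)%N -> has_quot_limit (x a) (y a) (y (a + b)%N)) ->
  all (leq 1) es ->
  has_quot_limit (fun n => expR (u n) * \prod_(a <- es) x a n)%R
    (expR l * \prod_(a <- es) y a)%R
    (expR l * (\prod_(a <- rcons es b) y a +
               \sum_(cs <- incr_each b es) \prod_(a <- cs) y a))%R.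
Proof.
move=> ul xy es0; rewrite mulrDr -cats1 big_cat big_seq1/= mulrA mulrAC.
by apply: has_quot_limitM; [exact: has_quot_limit_expR|exact: has_quot_limit_prod].
Qed.

End difference_quotient.

(** Extension by 0 turns integrals over ]0, +oo[ into integrals over the whole line, also for
    [a = 0], where the power alone would be 1 everywhere. *)
Definition pospow (R : realType) (a : nat) (x : R) : R :=
  if (0 < x)%R then (x ^+ a)%R else 0%R.

Lemma pospow_ge0 (R : realType) a (x : R) : (0 <= pospow a x)%R.
Proof. by rewrite /pospow; case: ifPn => // x0; rewrite exprn_ge0// ltW. Qed.

Lemma pospow_le0 (R : realType) a (x : R) : (x <= 0)%R -> pospow a x = 0%R.
Proof. by rewrite leNgt /pospow => /negPf ->. Qed.

Lemma pospowE (R : realType) a (x : R) : (0 < a)%N -> (0 <= x)%R ->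
  pospow a x = (x ^+ a)%R.
Proof.
move=> a0; rewrite le_eqVlt => /predU1P[<-|x0]; last by rewrite /pospow x0.
by rewrite pospow_le0// expr0n gtn_eqF.
Qed.

Lemma pospowD (R : realType) a b (x : R) :
  (pospow (a + b) x = pospow a x * pospow b x)%R.
Proof. by rewrite /pospow; case: ifPn => _; rewrite ?mulr0// exprD. Qed.

Lemma measurable_pospow (R : realType) a : measurable_fun setT (@pospow R a).
Proof. by apply: measurable_fun_ifT => //; exact: measurable_fun_ltr. Qed.

(** Minus the derivative at 0+ of t |-> int W e^{-t H}. Only [W] has to be integrable: the limit may
    be +oo, so knowing by other means that the quotients have a finite limit proves [W * H]
    integrable. *)
Lemma cvg_integral_quotient d (T : measurableType d) (R : realType)
    (mu : {measure set T -> \bar R}) (W H : T -> \bar R) :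
  measurable_fun setT W -> measurable_fun setT H ->
  (forall x, 0 <= W x) -> (forall x, 0 <= H x) -> \int[mu]_x W x < +oo ->
  (2 ^+ n * (fine (\int[mu]_x W x) -
     fine (\int[mu]_x (W x * (expN ((2 ^- n)%:E * H x))%:E))))%:E @[n --> \oo]
  --> \int[mu]_x (W x * H x).
Proof.
move=> mW mH W0 H0 Wfin.
have := cvg_integral_expN_quot (mu := mu) mW mH W0 H0; apply: cvg_trans.
apply: near_eq_cvg; apply: nearW => n.
have me : measurable_fun setT (fun x => (expN ((2 ^- n)%:E * H x))%:E).
  apply/measurable_EFinP/measurable_expN_comp; exact: measurable_funeM.
have mq : measurable_fun setT (fun x => (expN_quot n (H x))%:E).
  by apply/measurable_EFinP; exact: (measurableT_comp (measurable_expN_quot n)).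
have i0 : 0 <= \int[mu]_x (W x * (expN ((2 ^- n)%:E * H x))%:E).
  by apply: integral_ge0 => x _; rewrite mule_ge0// lee_fin expN_ge0.
have q0 : 0 <= \int[mu]_x (W x * (expN_quot n (H x))%:E).
  by apply: integral_ge0 => x _; rewrite mule_ge0// lee_fin expN_quot_ge0.
(* The quotient is written without subtraction; finiteness of the left side then makes both terms on
   the right finite. *)
have : \int[mu]_x W x = \int[mu]_x (W x * (expN ((2 ^- n)%:E * H x))%:E) +
    (2 ^- n)%:E * \int[mu]_x (W x * (expN_quot n (H x))%:E).
  rewrite -ge0_integralZl//; last 2 first.
  - exact: emeasurable_funM.
  - by move=> x _; rewrite mule_ge0// lee_fin expN_quot_ge0.
  rewrite -ge0_integralD//; last 4 first.
  - by move=> x _; rewrite mule_ge0// lee_fin expN_ge0.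
  - exact: emeasurable_funM.
  - by move=> x _; rewrite mule_ge0 ?lee_fin ?invr_ge0 ?exprn_ge0// mule_ge0// lee_fin expN_quot_ge0.
  - by apply: measurable_funeM; exact: emeasurable_funM.
  apply: eq_integral => x _; rewrite muleCA -ge0_muleDr ?lee_fin ?expN_ge0//; last first.
    by rewrite mulr_ge0 ?invr_ge0 ?exprn_ge0// expN_quot_ge0.
  rewrite -EFinM -EFinD /expN_quot mulrA mulVf ?expf_neq0// mul1r addrC subrK.
  by rewrite mule1.
have w0 : 0 <= \int[mu]_x W x by exact: integral_ge0.
case: (\int[mu]_x W x) Wfin w0 => [w||]// _ _.
move: i0 q0; case: integral => [i||]//; case: integral => [q||]// _ _.
- move=> [->] /=; rewrite [(i + _)%R]addrC addrK mulrA divff ?expf_neq0//.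
  by rewrite mul1r.
- by rewrite gt0_muley ?lte_fin ?invr_gt0 ?exprn_gt0.
- by rewrite gt0_muley ?lte_fin ?invr_gt0 ?exprn_gt0.
Qed.

Lemma integral_comp_nnsfun d (T : measurableType d) (R : realType)
    (mu : {measure set T -> \bar R}) (h : {nnsfun T >-> R}) (psi : R -> R)
    (s : seq R) :
  uniq s -> (forall x, h x \in s) -> {in s, forall y, 0 <= psi y}%R ->
  \int[mu]_x (psi (h x))%:E = \sum_(y <- s) (psi y)%:E * mu (h @^-1` [set y]).
Proof.
move=> us hs psi0.
transitivity (\int[mu]_x \sum_(y <- s)
    ((Num.max 0 (psi y))%:E * (\1_(h @^-1` [set y]) x)%:E)).
  apply: eq_integral => x _.
  rewrite (big_rem (h x))//= [X in _ = _ + X]big1_seq ?adde0; last first.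
    move=> y /andP[_]; rewrite mem_rem_uniq// inE => /andP[yhx _].
    by rewrite indicE memNset ?mule0// => /= /esym/eqP; exact/negP.
  by rewrite indicE mem_set// mule1 (max_idPr _)// psi0.
rewrite ge0_integral_sum//; first last.
- by move=> y x _; rewrite mule_ge0// lee_fin ?le_max ?lexx.
- by move=> y; apply: emeasurable_funM => //; apply/measurable_EFinP.
rewrite big_seq [RHS]big_seq; apply: eq_bigr => y ys.
rewrite ge0_integralZl_EFin//; last by rewrite le_max lexx.
  by rewrite integral_indic// setIT (max_idPr _)// psi0.
exact/measurable_EFinP.
Qed.

Lemma expN_sum (R : realType) (I : Type) (s : seq I) (F : I -> \bar R) :
  (forall i, 0 <= F i) ->
  (expN (\sum_(i <- s) F i) = \prod_(i <- s) expN (F i))%R.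
Proof.
move=> F0; elim: s => [|i s IH].
  by rewrite !big_nil expN_fin// oppr0 expR0.
by rewrite !big_cons expND ?IH// sume_ge0.
Qed.

(** As integrals against a counting measure, sums over the points become accessible to simple
    functions and monotone convergence. *)
Lemma nneseries_dirac d (T : measurableType d) (R : realType) (x : nat -> T)
    (f : T -> \bar R) : measurable_fun setT f -> (forall t, 0 <= f t) ->
  \sum_(0 <= k <oo) f (x k) = \int[mseries (fun k => \d_(x k)) 0]_t f t.
Proof.
move=> mf f0; rewrite ge0_integral_measure_series//.
by apply: eq_eseriesr => k _; rewrite integral_dirac// diracT mul1e.
Qed.

(** * Laplace functional and Palm formula *)

Section laplace_functional.
Context (R : realType) (Omega : completeMetricType R) (d : measure_display)
  (T : measurableType d) (P : probability T R).
Variables (jump : nat -> {RV P >-> R}) (atom : nat -> {RV P >-> borel_space Omega}).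
Variables (G0 : {finite_measure set (borel_space Omega) -> \bar R})
  (rho : {measure set R -> \bar R}).
Hypothesis jump_ge0 : forall k w, (0 <= jump k w)%R.
Hypothesis points_poisson :
  poisson_random_measure P (rho \x G0) (point_process jump atom).

Lemma product_measure1_cylinder (B : set R) : measurable B ->
  (rho \x G0) (B `*` [set: borel_space Omega]) = rho B * G0 [set: borel_space Omega].
Proof.
move=> mB; rewrite /product_measure1.
rewrite (eq_integral (fun x => G0 [set: borel_space Omega] * (\1_B x)%:E)).
  rewrite ge0_integralZl//; last by apply/measurable_EFinP.
  by rewrite integral_indic// setIT muleC.
move=> x _ /=; rewrite indicE; case: (boolP (x \in B)) => xB.
  by rewrite in_xsectionX// mule1.
by rewrite notin_xsectionX// measure0 mule0.
Qed.

(** The set must avoid 0, because a term with null jump is a Dirac mass on the right but no point of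
    the process. *)
Lemma point_process_cylinder w (B : set R) : ~ B 0%R ->
  point_process jump atom w (B `*` setT) = \sum_(0 <= k <oo) \d_(jump k w) B.
Proof.
move=> B0; apply: eq_eseriesr => k _; rewrite !diracE; congr ((nat_of_bool _)%:R%:E).
apply/idP/idP; rewrite !inE; first by case=> -[].
move=> Bk; split => //; split => //=; rewrite in_itv/= andbT lt_neqAle jump_ge0.
by rewrite andbT; apply: contra_notN B0 => /eqP ->.
Qed.

Let gamma := G0 [set: borel_space Omega].

(** The sum is a combination of the counts of the disjoint cylinders over the level sets of [h].
    These are independent and Poisson, possibly of infinite rate, so the expectation is a product of
    Poisson transforms. *)
Lemma laplace_functional_nnsfun (h : {nnsfun R >-> R}) : h 0%R = 0%R ->
  \int[P]_w (expN (\sum_(0 <= k <oo) (h (jump k w))%:E))%:E =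
  (expN (gamma * \int[rho]_x (1 - expR (- h x))%:E))%:E.
Proof.
move=> h0; have [mpp ppp ipp] := points_poisson.
have /finite_seqP[s0 hs0] : finite_set (range h) by [].
pose s := undup s0; pose ys := in_tuple s.
have sP y : y \in s -> exists x, h x = y.
  rewrite mem_undup => ys0.
  have : range h y by rewrite hs0.
  by case=> x _ <-; exists x.
have hs x : h x \in s.
  have : range h (h x) by exists x.
  by rewrite mem_undup hs0.
have s_ge0 y : y \in s -> (0 <= y)%R by move=> /sP[x <-]; exact: fun_ge0.
have us : uniq s by exact: undup_uniq.
pose A i := (h @^-1` [set tnth ys i] `*` [set: borel_space Omega]).
have mh y : measurable (h @^-1` [set y]) by [].
have mA i : measurable (A i) by exact: measurableX.
have ys0 i : (0 <= tnth ys i)%R by exact/s_ge0/mem_tnth.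
have tA : trivIset setT A.
  apply/trivIsetP => i j _ _ ij; apply/seteqP; split => // -[x o].
  rewrite /A/= => -[[-> _] [/eqP]]; rewrite (tnth_nth 0%R) (tnth_nth 0%R ys j).
  by rewrite nth_uniq// (inj_eq val_inj) (negPf ij).
have sumE w : \sum_(0 <= k <oo) (h (jump k w))%:E =
    \sum_(i < size s)
      (tnth ys i)%:E * point_process jump atom w (A i).
  rewrite (@nneseries_dirac _ _ _ (fun k => jump k w) (EFin \o h)); last 2 first.
  - exact/measurable_EFinP.
  - by move=> t; rewrite lee_fin.
  rewrite (@integral_comp_nnsfun _ _ _ _ _ id s)//=.
  rewrite big_tnth.
  apply: eq_bigr => i _.
  (* As [h 0 = 0], the level set of the value 0 is the only one containing 0; its count may differ
     from the sum of Dirac masses, but has coefficient 0. *)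
  have [->|yi0] := eqVneq (tnth (in_tuple s) i) 0%R.
    by rewrite !mul0e.
  rewrite point_process_cylinder//= h0 => /esym/eqP; exact/negP.
have pp0 w i : 0 <= point_process jump atom w (A i) by apply: nneseries_ge0.
have psi0 y : (0 <= y)%R -> (0 <= 1 - expR (- y) :> R)%R.
  by move=> y0; rewrite subr_ge0 -[leRHS](@expR0 R) ler_expR oppr_le0.
have prod0 i : 0 <= (rho \x G0) (A i) by [].
rewrite (eq_integral (fun w => (\prod_(i < size s)
    expN ((tnth ys i)%:E * point_process jump atom w (A i)))%:E)); last first.
  by move=> w _; rewrite sumE expN_sum// => i; rewrite mule_ge0// lee_fin.
rewrite (@expectation_prod_independent _ _ _ _ _
  (fun i w => point_process jump atom w (A i))
  (fun i x => expN ((tnth ys i)%:E * x))); first last.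
- by move=> i x; exact: expN_itv.
- by move=> i; apply: measurable_expN_comp; exact: measurable_funeM.
- exact: ipp.
- by move=> i; exact: mpp.
rewrite (eq_bigr (fun i => (expN ((rho \x G0) (A i) *
    (1 - expR (- tnth ys i))%:E))%:E)); last first.
  by move=> i _; apply: poisson_count_laplace => //; [exact: mpp|exact: ppp].
rewrite prodEFin -expN_sum; last first.
  by move=> i; rewrite mule_ge0// lee_fin psi0.
rewrite (@integral_comp_nnsfun _ _ _ _ _ (fun y => 1 - expR (- y))%R s)//; last first.
  by move=> y /s_ge0/psi0.
congr (expN _)%:E; rewrite [X in gamma * X]big_tnth ge0_sume_distrr; last first.
  by move=> i _; rewrite mule_ge0// lee_fin psi0.
by apply: eq_bigr => i _; rewrite product_measure1_cylinder// muleC muleA muleC.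
Qed.

Lemma measurable_nneseries_jump (f : R -> R) : measurable_fun setT f ->
  (forall x, 0 <= f x)%R ->
  measurable_fun setT (fun w => \sum_(0 <= k <oo) (f (jump k w))%:E).
Proof.
move=> mf f0; apply: (ge0_emeasurable_sum (P := xpredT)).
  by move=> k x _ _; rewrite lee_fin.
by move=> k _; apply/measurable_EFinP; exact: measurableT_comp.
Qed.

Lemma laplace_functional (f : R -> R) : measurable_fun setT f ->
  (forall x, 0 <= f x)%R -> f 0%R = 0%R ->
  \int[P]_w (expN (\sum_(0 <= k <oo) (f (jump k w))%:E))%:E =
  (expN (gamma * \int[rho]_x (1 - expR (- f x))%:E))%:E.
Proof.
move=> mf f0 f00.
have mf' : measurable_fun setT (EFin \o f) by apply/measurable_EFinP.
have [h [ndh hf]] := approximation measurableT mf' (fun x _ => f0 x).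
have ndhx x : {homo (fun n => (h n x)%:E) : n m / (n <= m)%N >-> n <= m}.
  by move=> n m nm; rewrite lee_fin; have /lefP := ndh _ _ nm.
(* The approximants increase to [f], hence lie below it and inherit its zero at 0. *)
have h0 n : h n 0%R = 0%R.
  apply/eqP; rewrite eq_le fun_ge0 andbT -lee_fin.
  have hf0 : (h m 0%R)%:E @[m --> \oo] --> (0%R%:E : \bar R).
    by have := hf 0%R I; rewrite /= f00.
  rewrite -(cvg_lim (@ereal_hausdorff R) hf0).
  apply: lime_ge; first by apply/cvg_ex; exists 0%E.
  by exists n => // m /= nm; exact: (ndhx 0%R).
have cvgS w : \sum_(0 <= k <oo) (h n (jump k w))%:E @[n --> \oo] -->
    \sum_(0 <= k <oo) (f (jump k w))%:E.
  rewrite (@nneseries_dirac _ _ _ (fun k => jump k w) (EFin \o f))//.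
  under eq_fun => n.
    rewrite (@nneseries_dirac _ _ _ (fun k => jump k w) (EFin \o h n)); last 2 first.
    - exact/measurable_EFinP.
    - by move=> t; rewrite lee_fin.
    over.
  apply: monotone_cvg_integral => //.
  - by move=> n; exact/measurable_EFinP.
  - by move=> n x; rewrite lee_fin.
  - by move=> x; exact: hf.
(* The left integrands decrease, but are bounded by 1 on a probability space, so domination applies
   there; on the right, 1 - e^{-h} increases with [h]. *)
have Lcvg : \int[P]_w (expN (\sum_(0 <= k <oo) (h n (jump k w))%:E))%:E @[n --> \oo]
    --> \int[P]_w (expN (\sum_(0 <= k <oo) (f (jump k w))%:E))%:E.
  have [] // := @dominated_convergence _ _ _ P setT measurableT
    (fun n w => (expN (\sum_(0 <= k <oo) (h n (jump k w))%:E))%:E)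
    (fun w => (expN (\sum_(0 <= k <oo) (f (jump k w))%:E))%:E) (cst 1).
  - move=> n; apply/measurable_EFinP/measurable_expN_comp.
    by apply: measurable_nneseries_jump => // x; exact: fun_ge0.
  - by apply/measurable_EFinP/measurable_expN_comp; exact: measurable_nneseries_jump.
  - apply: aeW => w _; apply/cvg_EFin; first exact: nearW.
    by apply: cvg_expN (cvgS w) => n; apply: nneseries_ge0 => k _ _; rewrite lee_fin.
  - exact: finite_measure_integrable_cst.
  - apply: aeW => w n _; rewrite gee0_abs ?lee_fin ?expN_ge0//.
    by case/andP: (expN_itv (\sum_(0 <= k <oo) (h n (jump k w))%:E)).
have psi0 y : (0 <= y)%R -> (0 <= 1 - expR (- y) :> R)%R.
  by move=> y0; rewrite subr_ge0 -[leRHS](@expR0 R) ler_expR oppr_le0.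
have Rcvg : (expN (gamma * \int[rho]_x (1 - expR (- h n x))%:E))%:E @[n --> \oo]
    --> (expN (gamma * \int[rho]_x (1 - expR (- f x))%:E))%:E.
  apply/cvg_EFin; first exact: nearW.
  apply: cvg_expN.
    move=> n; apply: mule_ge0; first exact: measure_ge0.
    apply: integral_ge0 => x _.
    by rewrite lee_fin psi0.
  apply: cvgeZl; first exact: fin_num_measure.
  apply: monotone_cvg_integral.
  - move=> n; apply/measurable_EFinP/measurable_funB => //.
    by apply: measurableT_comp => //; exact: measurable_funN.
  - by move=> n x; rewrite lee_fin psi0.
  - move=> x n m nm; rewrite lee_fin lerD2l lerN2 ler_expR lerN2.
    by rewrite -lee_fin; exact: ndhx.
  - move=> x; apply/cvg_EFin; first exact: nearW.
    apply: cvgB; first exact: cvg_cst.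
    apply: continuous_cvg; first exact: continuous_expR.
    by apply: cvgN; exact: (fine_cvg (hf x I)).
move: Lcvg; under eq_fun do rewrite laplace_functional_nnsfun//.
move=> /(cvg_lim (@ereal_hausdorff R)) <-.
exact: cvg_lim Rcvg.
Qed.

(** The lower bound by s makes all positive moments under e^{-g} finite; the last condition makes
    the Laplace functional at [g] a positive number. The function s itself, extended by 0, is the
    instance used in the end. *)
Definition admissible (g : R -> R) : Prop :=
  [/\ measurable_fun setT g, (forall x, x <= 0 -> g x = 0)%R,
      (forall x, pospow 1 x <= g x)%R &
      \int[rho]_x (1 - expR (- g x))%:E < +oo].

Definition tilted_moment (a : nat) (g : R -> R) : R :=
  fine (\int[rho]_x (pospow a x * expR (- g x))%:E).

Definition laplace_exponent (g : R -> R) : R :=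
  fine (\int[rho]_x (1 - expR (- g x))%:E).

Let gamma0 := fine gamma.

Let gammaE : gamma = gamma0%:E.
Proof. by rewrite fineK// fin_num_measure. Qed.

Let gamma0_ge0 : (0 <= gamma0)%R.
Proof. exact/fine_ge0/measure_ge0. Qed.

Lemma admissible_ge0 g x : admissible g -> (0 <= g x)%R.
Proof. by case=> _ _ g1 _; rewrite (le_trans (pospow_ge0 1 x)). Qed.

Lemma one_sub_expRN_ge0 (y : R) : (0 <= y)%R -> (0 <= 1 - expR (- y))%R.
Proof. by move=> y0; rewrite subr_ge0 -[leRHS](@expR0 R) ler_expR oppr_le0. Qed.

Lemma measurable_expRN (g : R -> R) : measurable_fun setT g ->
  measurable_fun setT (fun x => expR (- g x)).
Proof. by move=> mg; apply: measurableT_comp => //; exact: measurable_funN. Qed.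

Lemma measurable_tilted_density a (g : R -> R) : measurable_fun setT g ->
  measurable_fun setT (fun x => (pospow a x * expR (- g x))%:E).
Proof.
move=> mg; apply/measurable_EFinP/measurable_funM; first exact: measurable_pospow.
exact: measurable_expRN.
Qed.

Lemma tilted_density_ge0 a (g : R -> R) x : 0 <= (pospow a x * expR (- g x))%:E.
Proof. by rewrite lee_fin mulr_ge0 ?pospow_ge0 ?expR_ge0. Qed.

(** From s^a / a! <= e^s - 1 <= e^g - 1 follows s^a e^{-g} <= a! (1 - e^{-g}), whose integral is
    finite. The comparison uses [a > 0]: [rho] may have infinite mass near 0. *)
Lemma tilted_moment_lty a g : (0 < a)%N -> admissible g ->
  \int[rho]_x (pospow a x * expR (- g x))%:E < +oo.
Proof.
move=> a0 ag; have [mg g0 g1 gfin] := ag.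
have m1 : measurable_fun setT (fun x => (1 - expR (- g x))%:E).
  by apply/measurable_EFinP/measurable_funB => //; exact: measurable_expRN.
apply: (@le_lt_trans _ _ (\int[rho]_x ((a`!%:R)%:E * (1 - expR (- g x))%:E))).
  apply: ge0_le_integral => //.
  - by move=> x _; exact: tilted_density_ge0.
  - exact: measurable_tilted_density.
  - exact: measurable_funeM.
  - move=> x _; rewrite -EFinM lee_fin /pospow; case: ifPn => [x0|]; last first.
      by rewrite -leNgt => x0; rewrite mul0r g0// oppr0 expR0 subrr mulr0.
    have gx : (x <= g x)%R by have := g1 x; rewrite /pospow x0 expr1.
    have xa : (x ^+ a / a`!%:R <= expR x - 1)%R.
      by rewrite lerBrDl -[a]prednK// expR_ge1Dxn// ltW.
    have fa : (0 < a`!%:R :> R)%R by rewrite ltr0n fact_gt0.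
    have xg : (x ^+ a <= a`!%:R * (expR (g x) - 1))%R.
      rewrite mulrC -ler_pdivrMr// (le_trans xa)// lerD2r.
      by rewrite ler_expR.
    apply: (le_trans (ler_wpM2r (expR_ge0 _) xg)).
    by rewrite -mulrA mulrBl expRxMexpNx_1 mul1r.
rewrite ge0_integralZl_EFin//; last first.
  by move=> x _; rewrite lee_fin one_sub_expRN_ge0// admissible_ge0.
by rewrite lte_mul_pinfty// ?lee_fin.
Qed.

Lemma tilted_moment_ge0 a g : (0 <= tilted_moment a g)%R.
Proof. by apply/fine_ge0/integral_ge0 => x _; exact: tilted_density_ge0. Qed.

Lemma tilted_momentE a g : (0 < a)%N -> admissible g ->
  (tilted_moment a g)%:E = \int[rho]_x (pospow a x * expR (- g x))%:E.
Proof.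
move=> a0 ag; rewrite fineK// ge0_fin_numE ?tilted_moment_lty//.
by apply: integral_ge0 => x _; exact: tilted_density_ge0.
Qed.

Lemma laplace_exponentE g : admissible g ->
  (laplace_exponent g)%:E = \int[rho]_x (1 - expR (- g x))%:E.
Proof.
move=> ag; have [_ _ _ gfin] := ag; rewrite fineK// ge0_fin_numE//.
by apply: integral_ge0 => x _; rewrite lee_fin one_sub_expRN_ge0// admissible_ge0.
Qed.

Lemma expRN_perturb (g : R -> R) b n x :
  (expR (- (g x + 2 ^- n * pospow b x)) =
   expR (- g x) * expN ((2 ^- n)%:E * (pospow b x)%:E))%R.
Proof.
rewrite opprD expRD -EFinM expN_fin// mulr_ge0 ?invr_ge0 ?exprn_ge0//.
exact: pospow_ge0.
Qed.

(** With h = 2^-n, the increment of the integrand is e^{-g} (1 - e^{-h s^b}), that is, h e^{-g}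
    times the quotient at s^b. The identity gives both the finiteness of the perturbed exponent and
    its derivative. *)
Lemma laplace_exponent_perturb g b n : admissible g -> (0 < b)%N ->
  \int[rho]_x (1 - expR (- (g x + 2 ^- n * pospow b x)))%:E =
  \int[rho]_x (1 - expR (- g x))%:E +
  (2 ^- n)%:E * \int[rho]_x ((expR (- g x))%:E * (expN_quot n (pospow b x)%:E)%:E).
Proof.
move=> ag b0; have [mg g0 g1 gfin] := ag.
have me : measurable_fun setT (fun x => (expR (- g x))%:E).
  by apply/measurable_EFinP; exact: measurable_expRN.
have mq : measurable_fun setT (fun x : R => (expN_quot n (pospow b x)%:E)%:E).
  apply/measurable_EFinP; apply: (measurableT_comp (measurable_expN_quot n)).
  by apply/measurable_EFinP; exact: measurable_pospow.
have q0 x : (0 <= expR (- g x))%R && (0 <= expN_quot n (pospow b x)%:E)%R.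
  by rewrite expR_ge0 expN_quot_ge0.
rewrite -ge0_integralZl_EFin ?invr_ge0 ?exprn_ge0//; last 2 first.
- by move=> x _; rewrite -EFinM lee_fin mulr_ge0 ?expR_ge0 ?expN_quot_ge0.
- exact: emeasurable_funM.
rewrite -ge0_integralD//; last 4 first.
- by move=> x _; rewrite lee_fin one_sub_expRN_ge0// admissible_ge0.
- by apply/measurable_EFinP/measurable_funB => //; exact: measurable_expRN.
- move=> x _; rewrite -!EFinM lee_fin mulr_ge0 ?invr_ge0 ?exprn_ge0//.
  by case/andP: (q0 x) => ? ?; exact: mulr_ge0.
- by apply: measurable_funeM; exact: emeasurable_funM.
apply: eq_integral => x _; rewrite expRN_perturb /expN_quot -!EFinM -EFinD.
congr EFin; set e := expN _; set f := expR _.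
have -> : (2 ^- n * (f * (2 ^+ n * (1 - e))) = f * (1 - e) :> R)%R.
  by rewrite mulrCA (mulrA (2 ^- n)%R) mulVf ?expf_neq0// mul1r.
by ring.
Qed.

Lemma admissible_perturb g b n : admissible g -> (0 < b)%N ->
  admissible (fun x => g x + 2 ^- n * pospow b x)%R.
Proof.
move=> ag b0; have [mg g0 g1 gfin] := ag; split.
- apply: measurable_funD => //; apply: measurable_funM => //.
  exact: measurable_pospow.
- by move=> x x0; rewrite g0// pospow_le0// mulr0 addr0.
- move=> x; rewrite (le_trans (g1 x))// lerDl.
  by rewrite mulr_ge0 ?pospow_ge0// invr_ge0 exprn_ge0.
- rewrite laplace_exponent_perturb//; apply: lte_add_pinfty => //.
  apply: lte_mul_pinfty; rewrite ?lee_fin ?invr_ge0 ?exprn_ge0//.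
  (* The quotient at s^b is at most s^b, so the increment is controlled by the moment of order
     [b]. *)
  apply: le_lt_trans (tilted_moment_lty b0 ag).
  apply: ge0_le_integral => //.
  + by move=> x _; rewrite -EFinM lee_fin mulr_ge0 ?expR_ge0 ?expN_quot_ge0.
  + apply: emeasurable_funM; first by apply/measurable_EFinP; exact: measurable_expRN.
    apply/measurable_EFinP; apply: (measurableT_comp (measurable_expN_quot n)).
    by apply/measurable_EFinP; exact: measurable_pospow.
  + exact: measurable_tilted_density.
  + move=> x _; rewrite -EFinM lee_fin mulrC ler_wpM2r ?expR_ge0//.
    by rewrite expN_quot_le// pospow_ge0.
Qed.

Lemma has_quot_limit_tilted_moment a b g : admissible g -> (0 < a)%N ->
  (0 < b)%N ->
  has_quot_limit
    (fun n => tilted_moment a (fun x => g x + 2 ^- n * pospow b x)%R)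
    (tilted_moment a g) (tilted_moment (a + b) g).
Proof.
move=> ag a0 b0; have [mg _ _ _] := ag.
have mb : measurable_fun setT (fun x : R => (pospow b x)%:E).
  by apply/measurable_EFinP; exact: measurable_pospow.
have := @cvg_integral_quotient _ _ _ rho
  (fun x => (pospow a x * expR (- g x))%:E) (fun x => (pospow b x)%:E)
  (measurable_tilted_density a mg) mb (tilted_density_ge0 a g)
  (fun x => pospow_ge0 b x) (tilted_moment_lty a0 ag).
have -> : \int[rho]_x ((pospow a x * expR (- g x))%:E * (pospow b x)%:E) =
    (tilted_moment (a + b) g)%:E.
  rewrite tilted_momentE ?addn_gt0 ?a0//; apply: eq_integral => x _.
  by rewrite pospowD -EFinM; congr EFin; ring.
move=> /fine_cvg; apply: cvg_trans; apply: near_eq_cvg; apply: nearW => n /=.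
rewrite /tilted_moment; congr (_ * (_ - fine _))%R.
by apply: eq_integral => x _; rewrite expRN_perturb mulrA.
Qed.

(** Here e^{-g} may have infinite integral, so [cvg_integral_quotient] does not apply; the integrals
    of the quotients are passed to the limit directly. *)
Lemma has_quot_limit_laplace_exponent b g : admissible g -> (0 < b)%N ->
  has_quot_limit
    (fun n => - laplace_exponent (fun x => g x + 2 ^- n * pospow b x))%R
    (- laplace_exponent g)%R (tilted_moment b g).
Proof.
move=> ag b0; have [mg _ _ gfin] := ag.
have mb : measurable_fun setT (fun x : R => (pospow b x)%:E).
  by apply/measurable_EFinP; exact: measurable_pospow.
have me : measurable_fun setT (fun x => (expR (- g x))%:E).
  by apply/measurable_EFinP; exact: measurable_expRN.
have := @cvg_integral_expN_quot _ _ _ rho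
  (fun x => (expR (- g x))%:E) (fun x => (pospow b x)%:E) me mb
  (fun x => expR_ge0 _) (fun x => pospow_ge0 b x).
have -> : \int[rho]_x ((expR (- g x))%:E * (pospow b x)%:E) =
    (tilted_moment b g)%:E.
  by rewrite tilted_momentE//; apply: eq_integral => x _; rewrite -EFinM mulrC.
move=> /fine_cvg; apply: cvg_trans; apply: near_eq_cvg; apply: nearW => n /=.
have := laplace_exponent_perturb n ag b0.
rewrite -laplace_exponentE; last exact: admissible_perturb.
rewrite -laplace_exponentE//.
set q := integral _ _ _; have : 0 <= q.
  by apply: integral_ge0 => x _; rewrite -EFinM lee_fin mulr_ge0 ?expR_ge0 ?expN_quot_ge0.
case: q => [q||]//= q0; last by rewrite gt0_muley// lte_fin invr_gt0 exprn_gt0.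
move=> [->]; rewrite opprK addrCA addrA addrN add0r mulrA divff ?expf_neq0//.
by rewrite mul1r.
Qed.

Lemma has_quot_limit_laplace_weight b g es : admissible g -> (0 < b)%N ->
  all (leq 1) es ->
  has_quot_limit
    (fun n => expR (- (gamma0 *
         laplace_exponent (fun x => g x + 2 ^- n * pospow b x))) *
       \prod_(a <- es)
         (gamma0 * tilted_moment a (fun x => g x + 2 ^- n * pospow b x)))%R
    (expR (- (gamma0 * laplace_exponent g)) *
       \prod_(a <- es) (gamma0 * tilted_moment a g))%R
    (expR (- (gamma0 * laplace_exponent g)) *
       (\prod_(a <- rcons es b) (gamma0 * tilted_moment a g) +
       \sum_(cs <- incr_each b es) \prod_(a <- cs) (gamma0 * tilted_moment a g)))%R.
Proof.
move=> ag b0 es0.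
apply: (@has_quot_limit_weight R
  (fun n => - (gamma0 *
     laplace_exponent (fun x => g x + 2 ^- n * pospow b x)))%R
  (- (gamma0 * laplace_exponent g))%R
  (fun a n => gamma0 *
     tilted_moment a (fun x => g x + 2 ^- n * pospow b x))%R
  (fun a => gamma0 * tilted_moment a g)%R b es) => // [|a a0].
- have := has_quot_limit_laplace_exponent ag b0; exact: has_quot_limitZN.
- have := has_quot_limit_tilted_moment ag a0 b0; exact: has_quot_limitZ.
Qed.

Let total (g : R -> R) w : \bar R := \sum_(0 <= k <oo) (g (jump k w))%:E.

Lemma laplace_admissible g : admissible g ->
  \int[P]_w (expN (total g w))%:E = (expR (- (gamma0 * laplace_exponent g)))%:E.
Proof.
move=> ag; have [mg g0 _ _] := ag; have g_ge0 x := admissible_ge0 x ag.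
rewrite laplace_functional ?g0// gammaE -laplace_exponentE// -EFinM expN_fin//.
by rewrite mulr_ge0//; apply/fine_ge0/integral_ge0 => x _; rewrite lee_fin one_sub_expRN_ge0.
Qed.

Lemma measurable_distinct_sum es u :
  measurable_fun setT (fun w => distinct_sum (fun k => jump k w) es u).
Proof.
elim: es u => [|a es IH] u /=; first exact: measurable_cst.
apply: ge0_emeasurable_sum.
  by move=> k w _ _; rewrite mule_ge0 ?lee_fin ?exprn_ge0 ?distinct_sum_ge0.
move=> k _; apply: emeasurable_funM => //.
by apply/measurable_EFinP; apply: measurable_funX.
Qed.

Lemma size_incr_each b es cs : all (leq 1) es -> cs \in incr_each b es ->
  size cs = size es /\ all (leq 1) cs.
Proof.
elim: es cs => [|a es IH] cs //= /andP[a0 es0]; rewrite inE => /predU1P[->/=|].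
  by rewrite ltn_addr.
by move=> /mapP[ds /(IH _ es0)[<- ds0] ->]; rewrite /= a0 ds0.
Qed.

Lemma palm_formula g es : admissible g -> all (leq 1) es ->
  \int[P]_w ((expN (total g w))%:E * distinct_sum (fun k => jump k w) es [::]) =
  (expR (- (gamma0 * laplace_exponent g)) *
    \prod_(a <- es) (gamma0 * tilted_moment a g))%:E.
Proof.
(* Induction on the length, for all lists and all [g]: the coincidence terms are lists of the same
   length as the shortened one, and the quotient calls the formula at perturbed functions. *)
move: {2}(size es) (erefl (size es)) => l; elim: l es g => [|l IH] es g.
  move=> /size0nil -> ag _; rewrite big_nil mulr1 -laplace_admissible//=.
  by under eq_integral do rewrite mule1.
(* The last entry is detached because multiplication by a power sum appends its exponent at the
   end. *)
case/lastP: es => [//|es b]; rewrite size_rcons => -[esl] ag.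
rewrite all_rcons => /andP[b0 es0]; have [mg _ _ _] := ag.
have g_ge0 x := admissible_ge0 x ag.
pose r w k := jump k w.
pose H w := \sum_(0 <= k <oo) (r w k ^+ b)%:E.
have HE w : H w = \sum_(0 <= k <oo) (pospow b (jump k w))%:E.
  by apply: eq_eseriesr => k _; rewrite pospowE.
pose W w := (expN (total g w))%:E * distinct_sum (r w) es [::].
have d0 w cs u : 0 <= distinct_sum (r w) cs u by apply: distinct_sum_ge0 => k; exact: jump_ge0.
have e0 w : 0 <= (expN (total g w))%:E by rewrite lee_fin expN_ge0.
have me : measurable_fun setT (fun w => (expN (total g w))%:E).
  by apply/measurable_EFinP/measurable_expN_comp; exact: measurable_nneseries_jump.
have mW cs : measurable_fun setT
    (fun w => (expN (total g w))%:E * distinct_sum (r w) cs [::]).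
  by apply: emeasurable_funM => //; exact: measurable_distinct_sum.
have W0 w : 0 <= W w by rewrite mule_ge0.
have mH : measurable_fun setT H.
  rewrite (_ : H = fun w => \sum_(0 <= k <oo) (pospow b (jump k w))%:E); last first.
    by apply/funext => w; exact: HE.
  by apply: measurable_nneseries_jump; [exact: measurable_pospow|exact: pospow_ge0].
have H0 w : 0 <= H w by apply: nneseries_ge0 => k _ _; rewrite lee_fin exprn_ge0// jump_ge0.
have WE : \int[P]_w W w = (expR (- (gamma0 * laplace_exponent g)) *
    \prod_(a <- es) (gamma0 * tilted_moment a g))%:E by exact: IH.
(* The integral of [W * H] is the limit of quotients that the induction hypothesis expresses by [g]
   and its perturbations, so the differentiation rules evaluate it. *)
have limWH : \int[P]_w (W w * H w) = (expR (- (gamma0 * laplace_exponent g)) *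
    (\prod_(a <- rcons es b) (gamma0 * tilted_moment a g) +
    \sum_(cs <- incr_each b es) \prod_(a <- cs) (gamma0 * tilted_moment a g)))%:E.
  have Wfin : \int[P]_w W w < +oo by rewrite WE ltry.
  have := @cvg_integral_quotient _ _ _ P W H (mW es) mH W0 H0 Wfin.
  move=> /(cvg_lim (@ereal_hausdorff R)) <-.
  apply: cvg_lim => //; apply/cvg_EFin; first exact: nearW.
  have := has_quot_limit_laplace_weight ag b0 es0; rewrite /has_quot_limit.
  apply: cvg_trans; apply: near_eq_cvg; apply: nearW => n /=.
  rewrite WE /=; congr (_ * (_ - _))%R.
  have := IH es _ esl (admissible_perturb n ag b0) es0.
  move=> /(congr1 fine)/= <-; congr fine.
  (* Summed over the points, the perturbation 2^-n s^b adds 2^-n [H] to the exponent: the weighted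
     integrand is the one of the perturbed function. *)
  apply: eq_integral => w _; rewrite /W muleAC -EFinM -expND ?mule_ge0 ?lee_fin ?invr_ge0 ?exprn_ge0//; last first.
    by apply: nneseries_ge0 => k _ _; rewrite lee_fin.
  congr ((expN _)%:E * _); rewrite HE /total -nneseriesZl; last first.
    by move=> k _; rewrite lee_fin pospow_ge0.
  rewrite -nneseriesD//; last 2 first.
  - by move=> k _ _; rewrite lee_fin.
  - by move=> k _ _; rewrite -EFinM lee_fin mulr_ge0 ?invr_ge0 ?exprn_ge0 ?pospow_ge0.
have splitWH : \int[P]_w (W w * H w) =
    \int[P]_w ((expN (total g w))%:E * distinct_sum (r w) (rcons es b) [::]) +
    \sum_(cs <- incr_each b es)
      \int[P]_w ((expN (total g w))%:E * distinct_sum (r w) cs [::]).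
  rewrite -ge0_integral_sum//; last by move=> cs w _; rewrite mule_ge0.
  rewrite -ge0_integralD//; last 3 first.
  - by move=> w _; rewrite mule_ge0.
  - by move=> w _; rewrite sume_ge0// => cs _; rewrite mule_ge0.
  - by apply: emeasurable_sum.
  apply: eq_integral => w _; rewrite /W -muleA (muleC _ (H w)) /H.
  rewrite power_sum_distinct_sum//; last by move=> k; exact: jump_ge0.
  by rewrite big_nil mul0e adde0 ge0_muleDr ?sume_ge0// ge0_sume_distrr.
move: limWH; rewrite splitWH.
under eq_big_seq => cs csin.
  have [cl cs0] := size_incr_each es0 csin.
  rewrite IH ?cl//; over.
rewrite sumEFin -mulr_sumr mulrDr.
(* The coincidence terms are the same finite number on both sides and cancel, leaving the list
   [rcons es b]. *)
by case: integral => [x||]//; rewrite -EFinD => -[/addIr ->].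
Qed.

End laplace_functional.

(** * Label sequences in order of appearance *)

Section labels_theory.
Implicit Types (s t z ks : seq nat) (f : nat -> nat).

Lemma size_undup_sub s t : {subset s <= t} -> (size (undup s) <= size (undup t))%N.
Proof.
move=> st; apply: uniq_leq_size; first exact: undup_uniq.
by move=> x; rewrite !mem_undup; exact: st.
Qed.

Lemma size_undup_map_in f s : {in s &, injective f} ->
  size (undup [seq f x | x <- s]) = size (undup s).
Proof.
move=> finj; rewrite -[RHS](size_map f); apply/perm_size/uniq_perm.
- exact: undup_uniq.
- rewrite map_inj_in_uniq ?undup_uniq// => x y.
  by rewrite !mem_undup; exact: finj.
- move=> x; rewrite mem_undup; apply/mapP/mapP => -[y ys ->]; exists y => //.
    by rewrite mem_undup.
  by rewrite mem_undup in ys.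
Qed.

Lemma index_map_in f s x : {in s &, injective f} -> x \in s ->
  index (f x) [seq f y | y <- s] = index x s.
Proof.
elim: s => //= y s IH finj; rewrite inE; have [->|yx] := eqVneq y x.
  by rewrite !eqxx.
rewrite /= => xs; rewrite ifN; last first.
  by apply: contra yx => /eqP/finj ->//; rewrite inE ?eqxx// xs orbT.
by rewrite IH// => a b sa sb; apply: finj; rewrite inE ?sa ?sb orbT.
Qed.

Lemma labels_map f z : {in z &, injective f} -> labels [seq f x | x <- z] = labels z.
Proof.
move=> finj; rewrite /labels -map_comp; apply/eq_in_map => x xz /=.
rewrite index_map_in// -map_take size_undup_map_in// => a b /mem_take az /mem_take bz.
exact: finj.
Qed.

(** The rank grows strictly with the position of first occurrence: the later value is itself new to
    the shorter prefix. *)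
Lemma label_inj s : {in s &, injective (fun x => size (undup (take (index x s).+1 s)))}.
Proof.
have mono x y : x \in s -> y \in s -> (index x s < index y s)%N ->
    (size (undup (take (index x s).+1 s)) < size (undup (take (index y s).+1 s)))%N.
  move=> xs ys xy; rewrite -[X in (X <= _)%N]/(size (y :: undup (take (index x s).+1 s))).
  apply: uniq_leq_size.
    rewrite /= undup_uniq andbT mem_undup; apply/negP => /[dup] yt /index_ltn.
    by rewrite ltnS leqNgt xy.
  move=> u; rewrite inE => /predU1P[->|]; rewrite !mem_undup.
    by rewrite in_take// .
  move=> ut; have us := mem_take ut; rewrite in_take//.
  by move: ut; rewrite in_take// !ltnS => /leq_trans; apply; exact: ltnW.
move=> x y xs ys /= xy; have [|yx|eq_idx] := ltngtP (index x s) (index y s).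
- by move=> /(mono _ _ xs ys); rewrite xy ltnn.
- by have := mono _ _ ys xs yx; rewrite xy ltnn.
- by rewrite -(nth_index 0%N xs) eq_idx nth_index.
Qed.

Lemma nth_labels_eq s i j : (i < size s)%N -> (j < size s)%N ->
  (nth 0%N (labels s) i == nth 0%N (labels s) j) = (nth 0%N s i == nth 0%N s j).
Proof.
move=> si sj; rewrite !(nth_map 0%N)//; apply/eqP/eqP => [|->//].
by apply: label_inj; exact: mem_nth.
Qed.

Variable z : seq nat.
Hypothesis labels_z : labels z = z.

Lemma labels_itv x : x \in z -> (0 < x <= num_clusters z)%N.
Proof.
rewrite -{1}labels_z => /mapP[y yz ->]; apply/andP; split.
  by rewrite -has_predT; apply/hasP; exists y => //; rewrite mem_undup in_take.
by apply: size_undup_sub => u; exact: mem_take.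
Qed.

(** A duplicate-free list of [num_clusters z] values inside an interval of that many integers fills
    the interval. *)
Lemma mem_labels x : (x \in z) = (0 < x <= num_clusters z)%N.
Proof.
have : undup z =i iota 1 (num_clusters z).
  apply: (uniq_min_size (undup_uniq z) _ _).2 => [y|].
    by rewrite mem_undup mem_iota add1n ltnS; exact: labels_itv.
  by rewrite size_iota.
by move=> /(_ x); rewrite mem_undup mem_iota add1n ltnS.
Qed.

(** An allocation with labels [z] is constant on each cluster, hence determined by the atoms at the
    first occurrences of the labels; distinct atoms conversely reproduce the labels. The shifts by
    one arise because labels start at 1 and positions in [ks] at 0. *)
Lemma labels_recover s ks : size s = size z -> uniq ks ->
  size ks = num_clusters z ->
  (labels s = z /\ forall j, (j < size ks)%N ->
     nth 0%N s (index j.+1 z) = nth 0%N ks j) <->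
  s = [seq nth 0%N ks x.-1 | x <- z].
Proof.
move=> sz uks ksl; split=> [[ls sks]|->].
  apply: (@eq_from_nth _ 0%N); first by rewrite size_map.
  move=> i si; have iz : (i < size z)%N by rewrite -sz.
  rewrite (nth_map 0%N)//; set x := nth 0%N z i.
  have xz : x \in z by exact: mem_nth.
  have /andP[x0 xl] := labels_itv xz.
  rewrite -sks ?ksl; last by rewrite prednK.
  rewrite prednK//; apply/eqP; rewrite -nth_labels_eq//; last by rewrite sz index_mem.
  by rewrite ls nth_index.
have inj : {in z &, injective (fun x => nth 0%N ks x.-1)}.
  move=> x y /labels_itv/andP[x0 xl] /labels_itv/andP[y0 yl] /eqP.
  rewrite nth_uniq ?ksl ?prednK// => /eqP xy.
  by rewrite -(prednK x0) -(prednK y0) xy.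
rewrite labels_map//; split => // j jl.
have jz : j.+1 \in z by rewrite mem_labels/= -ksl.
by rewrite (nth_map 0%N) ?index_mem// nth_index.
Qed.

Lemma labels_distinct s j j' : labels s = z ->
  j.+1 \in z -> j'.+1 \in z ->
  nth 0%N s (index j.+1 z) = nth 0%N s (index j'.+1 z) -> j = j'.
Proof.
move=> ls jz j'z /eqP; have sz : size s = size z by rewrite -ls size_map.
by rewrite -nth_labels_eq ?sz ?index_mem// ls !nth_index// eqSS => /eqP.
Qed.

Lemma prod_labels (R : comNzRingType) (F : nat -> R) :
  (\prod_(x <- z) F x =
   \prod_(0 <= j < num_clusters z) F j.+1 ^+ count_mem j.+1 z)%R.
Proof.
move: labels_itv; move: (num_clusters z) => l; elim: z => [_|x s IH xs].
  by rewrite big_nil big1// => j _; rewrite expr0.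
have /andP[x0 xl] : (0 < x <= l)%N by apply: xs; rewrite inE eqxx.
rewrite big_cons IH; last by move=> y ys; apply: xs; rewrite inE ys orbT.
under [RHS]eq_bigr do rewrite /= exprD.
rewrite big_split/=; congr *%R; rewrite big_mkord.
have xl' : (x.-1 < l)%N by rewrite prednK.
rewrite (bigD1 (Ordinal xl'))//= prednK// eqxx expr1 big1 ?mulr1// => j jx.
rewrite (_ : (x == j.+1) = false) ?expr0//; apply/negbTE; apply: contra jx.
by move=> /eqP xj; apply/eqP/val_inj; rewrite /= xj.
Qed.

End labels_theory.

Lemma integral_posE (R : realType) (mu : {measure set R -> \bar R})
    (f : R -> \bar R) :
  \int[mu]_(s in `]0%R, +oo[) f s =
  \int[mu]_s (if (0 < s)%R then f s else 0).
Proof.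
rewrite integral_mkcond; apply: eq_integral => s _; rewrite patchE.
case: ifPn => [|]; first by rewrite inE/= in_itv/= andbT => ->.
by rewrite notin_setE/= in_itv/= andbT => /negP/negPf ->.
Qed.

Lemma measurable_inv_ge0 d (T : measurableType d) (R : realType) (f : T -> R) :
  (forall x, 0 <= f x)%R -> measurable_fun setT f ->
  measurable_fun setT (fun x => (f x)^-1)%R.
Proof.
move=> f0 mf; under eq_fun do rewrite -powR_inv1//.
exact: (measurableT_comp (measurable_powR (-1)%R)).
Qed.

Section conditioning.
Context (R : realType) (d : measure_display) (T : measurableType d)
  (P : probability T R).

(** The defining identity covers events of the generated sigma-algebra only. Viewing the identity
    map as measurable into the coarser space lets [integral_transfer] extend it to weights [q], with
    densities [\1_A] and [f]. *)
Lemma is_cond_prob_integral (G : set (set T)) (A : set T) (f q : T -> R) :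
  G `<=` measurable -> measurable A ->
  measurable_fun setT f -> (forall w, 0 <= f w)%R ->
  is_cond_prob P <<s G>> A (EFin \o f) ->
  measurable_fun (setT : set (g_sigma_algebraType G)) q ->
  (forall w, 0 <= q w)%R ->
  \int[P]_w (q w * \1_A w)%:E = \int[P]_w (q w * f w)%:E.
Proof.
move=> GT mA mf f0 [_ Af] mq q0.
have mG (B : set T) : <<s G>> B -> measurable B.
  exact: (smallest_sub (sigma_algebra_measurable T) GT).
have mid : measurable_fun setT (id : T -> g_sigma_algebraType G).
  by move=> _ B GB; rewrite setTI; exact: mG.
apply: (@integral_transfer _ _ _ T T (g_sigma_algebraType G) R P P id id) => //.
move=> B GB; have mB := mG _ GB.
transitivity (P (A `&` B)).
  rewrite -[A `&` B in RHS]setIT -integral_indic//; last exact: measurableI.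
  by apply: eq_integral => w _; rewrite setIC indicI.
rewrite Af// [LHS]integral_mkcond; apply: eq_integral => w _.
by rewrite patchE indicE; case: ifPn => _; rewrite ?mul1r ?mul0r.
Qed.

End conditioning.

(** * Total mass, cluster probabilities and the law of the sample size *)

Section model_theory.
Context (R : realType) (Omega : completeMetricType R)
  (d : measure_display) (T : measurableType d) (P : probability T R).
Variables (jump : nat -> {RV P >-> R}) (atom : nat -> {RV P >-> borel_space Omega})
  (size_N : {RV P >-> nat}) (alloc : nat -> {RV P >-> nat}).
Variables (G0 : {finite_measure set (borel_space Omega) -> \bar R})
  (rho : {measure set R -> \bar R}).
Hypothesis rho_int : \int[rho]_(s in `]0%R, +oo[) (1 - expR (- s))%:E < +oo.
Hypothesis model : crm_mixed_poisson_model jump atom size_N alloc G0 rho.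

Let jump_ge0 : forall k w, (0 <= jump k w)%R := jump_ge0 model.
Let points_poisson := points_poisson model.

Lemma integral_pospow (psi : R -> R) : psi 0%R = 0%R ->
  \int[rho]_s (psi (pospow 1 s))%:E = \int[rho]_(s in `]0%R, +oo[) (psi s)%:E.
Proof.
move=> psi0; rewrite integral_posE; apply: eq_integral => s _.
by rewrite /pospow; case: ifPn => // _; rewrite psi0.
Qed.

Lemma admissible_pospow1 : admissible rho (@pospow R 1).
Proof.
split; [exact: measurable_pospow|by move=> x; exact: pospow_le0|by []|].
by rewrite (integral_pospow (psi := fun s => 1 - expR (- s))%R)// oppr0 expR0 subrr.
Qed.

Lemma tilted_moment_pospow1 a : (0 < a)%N ->
  (tilted_moment rho a (@pospow R 1))%:E =
  \int[rho]_(s in `]0%R, +oo[) (s ^+ a * expR (- s))%:E.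
Proof.
move=> a0; rewrite (tilted_momentE a0 admissible_pospow1).
rewrite integral_posE; apply: eq_integral => s _.
by rewrite /pospow; case: ifPn => // _; rewrite mul0r.
Qed.

Let mass w : \bar R := \sum_(0 <= k <oo) (jump k w)%:E.

Lemma massE w : mass w = \sum_(0 <= k <oo) (pospow 1 (jump k w))%:E.
Proof. by apply: eq_eseriesr => k _; rewrite pospowE// expr1. Qed.

Lemma mass_ge0 w : 0 <= mass w.
Proof. by apply: nneseries_ge0 => k _ _; rewrite lee_fin jump_ge0. Qed.

Lemma measurable_mass : measurable_fun setT mass.
Proof.
apply: (ge0_emeasurable_sum (P := xpredT)) => [k w _ _|k _].
  by rewrite lee_fin jump_ge0.
exact/measurable_EFinP.
Qed.

Lemma crm_setT w : crm jump atom w setT = mass w.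
Proof. by apply: eq_eseriesr => k _; rewrite diracT mule1. Qed.

(** The integrands tend to 0 pointwise and are dominated by 1 - e^{-s}, their value at step 1. *)
Lemma laplace_exponent_perturb_cvg0 :
  \int[rho]_s (1 - expR (- (2 ^- n * pospow 1 s)))%:E @[n --> \oo] --> 0.
Proof.
have [_ _ _ fin1] := admissible_pospow1.
have m1 n : measurable_fun setT (fun s : R => (1 - expR (- (2 ^- n * pospow 1 s)))%:E).
  apply/measurable_EFinP/measurable_funB => //; apply: measurable_expRN.
  by apply: measurable_funM => //; exact: measurable_pospow.
have p0 n s : (0 <= 2 ^- n * pospow 1 s :> R)%R.
  by rewrite mulr_ge0 ?invr_ge0 ?exprn_ge0 ?pospow_ge0.
have [] // := @dominated_convergence _ _ _ rho setT measurableT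
  (fun n s => (1 - expR (- (2 ^- n * pospow 1 s)))%:E) (cst 0)
  (fun s => (1 - expR (- pospow 1 s))%:E).
- apply: aeW => s _; apply/cvg_EFin; first exact: nearW.
  have e0 : (- (2 ^- n * pospow 1 s))%R @[n --> \oo] --> (- (0 * pospow 1 s : R))%R.
    by apply: cvgN; apply: cvgMl; exact: cvg_exprV2.
  have := cvg_comp _ _ e0 (@continuous_expR R _); rewrite mul0r oppr0 expR0 => e1.
  have : (1 - expR (- (2 ^- n * pospow 1 s)))%R @[n --> \oo] --> (1 - 1 : R)%R.
    by apply: cvgB; [exact: cvg_cst|exact: e1].
  by have -> : (1 - 1 = 0 :> R)%R by exact: subrr.
- apply/integrableP; split.
    by have := m1 0%N; under eq_fun do rewrite expr0 invr1 mul1r.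
  apply: le_lt_trans fin1; apply: ge0_le_integral => //.
  + apply: measurableT_comp => //.
    by have := m1 0%N; under eq_fun do rewrite expr0 invr1 mul1r.
  + by have := m1 0%N; under eq_fun do rewrite expr0 invr1 mul1r.
  + by move=> s _; rewrite gee0_abs// lee_fin one_sub_expRN_ge0// pospow_ge0.
- apply: aeW => s n _; rewrite gee0_abs ?lee_fin ?one_sub_expRN_ge0//.
  rewrite lerD2l lerN2 ler_expR lerN2 ler_piMl ?pospow_ge0// invf_le1 ?exprn_gt0//.
  by rewrite exprn_ege1// ler1n.
- move=> _; rewrite /= integral0_eq//.
Qed.

(** As e^{-h M} vanishes where the mass M is infinite, its expectation is at most the probability
    that M is finite; it tends to 1 as h = 2^-n tends to 0. *)
Lemma mass_lty_ae : {ae P, forall w, mass w < +oo}.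
Proof.
pose A := [set w | mass w = +oo].
have mA : measurable A.
  rewrite -[X in measurable X]setTI.
  exact: (measurable_mass measurableT (emeasurable_set1 +oo)).
exists A; split => //; last first.
  by move=> w; rewrite /A/= ltey => /negP/negPn/eqP.
have PAC n : (expN (G0 [set: borel_space Omega] *
      \int[rho]_s (1 - expR (- (2 ^- n * pospow 1 s)))%:E))%:E <=
    P (~` A).
  have p0 s : (0 <= 2 ^- n * pospow 1 s :> R)%R.
    by rewrite mulr_ge0 ?invr_ge0 ?exprn_ge0 ?pospow_ge0.
  have mf : measurable_fun setT (fun s => 2 ^- n * pospow 1 s : R)%R.
    by apply: measurable_funM => //; exact: measurable_pospow.
  rewrite -(laplace_functional jump_ge0 points_poisson mf p0); last first.
    by rewrite pospow_le0// mulr0.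
  have <- : \int[P]_w (\1_(~` A) w : R)%:E = P (~` A).
    by rewrite integral_indic ?setIT//; exact: measurableC.
  apply: ge0_le_integral => //.
  - by move=> w _; rewrite lee_fin expN_ge0.
  - by apply/measurable_EFinP/measurable_expN_comp; exact: (measurable_nneseries_jump jump mf p0).
  - by apply/measurable_EFinP/measurable_indic; exact: measurableC.
  - move=> w _; rewrite lee_fin indicE; case: (boolP (w \in _)).
      by case/andP: (expN_itv (\sum_(0 <= k <oo) (2 ^- n * pospow 1 (jump k w))%:E)).
    rewrite notin_setE/= => /contrapT; rewrite /A/= massE => moo.
    under eq_eseriesr do rewrite EFinM.
    rewrite nneseriesZl; last by move=> k _; rewrite lee_fin pospow_ge0.
    by rewrite moo gt0_muley ?lte_fin ?invr_gt0 ?exprn_gt0// /expN eqxx.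
have P1 : 1 <= P (~` A).
  have ge0 n : 0 <= G0 [set: borel_space Omega] *
      \int[rho]_s (1 - expR (- (2 ^- n * pospow 1 s)))%:E.
    apply: mule_ge0 => //; apply: integral_ge0 => s _.
    by rewrite lee_fin one_sub_expRN_ge0// mulr_ge0 ?invr_ge0 ?exprn_ge0 ?pospow_ge0.
  have c0 : G0 [set: borel_space Omega] *
      \int[rho]_s (1 - expR (- (2 ^- n * pospow 1 s)))%:E @[n --> \oo] --> 0.
    rewrite -(mule0 (G0 [set: borel_space Omega])); apply: cvgeZl.
      exact: fin_num_measure.
    exact: laplace_exponent_perturb_cvg0.
  have e1 : (expN (G0 [set: borel_space Omega] *
      \int[rho]_s (1 - expR (- (2 ^- n * pospow 1 s)))%:E))%:E @[n --> \oo] --> 1.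
    have := cvg_expN ge0 c0; rewrite expN_fin// oppr0 expR0 => c1.
    by apply/cvg_EFin; first exact: nearW.
  rewrite -(cvg_lim (@ereal_hausdorff R) e1).
  by apply: lime_le; [apply/cvg_ex; exists 1|exact: nearW].
apply/eqP; rewrite eq_le measure_ge0 andbT.
have := probability_setC P mA; move: P1 => /[swap] ->.
by rewrite leeBrDr ?fin_num_measure// -leeBrDl// subee.
Qed.

Lemma size_level_measurable n : measurable [set w | size_N w = n].
Proof.
by rewrite -[X in measurable X]setTI; exact: (measurable_funP size_N measurableT [set n]).
Qed.

Lemma alloc_level_measurable i k : measurable [set w | alloc i w = k].
Proof.
by rewrite -[X in measurable X]setTI; exact: (measurable_funP (alloc i) measurableT [set k]).
Qed.

Let points_generator : set (set T) :=
  \bigcup_k (preimage_set_system setT (jump k) measurable `|`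
             preimage_set_system setT (atom k) measurable).

Lemma points_generator_measurable : points_generator `<=` measurable.
Proof.
by move=> A [k _ [|]] [B mB <-]; [exact: measurable_funP|exact: measurable_funP].
Qed.

Let sigmaT := g_sigma_algebraType points_generator.

Lemma sigma_measurable_jump k :
  measurable_fun (setT : set sigmaT) (fun w => jump k w).
Proof.
move=> _ B mB; apply: sub_sigma_algebra; exists k => //; left.
by exists B.
Qed.

Lemma sigma_measurable_mass : measurable_fun (setT : set sigmaT) mass.
Proof.
apply: (ge0_emeasurable_sum (P := xpredT)) => [k w _ _|k _].
  by rewrite lee_fin jump_ge0.
by apply/measurable_EFinP; exact: sigma_measurable_jump.
Qed.

Let cmass w : R := crm_mass jump atom w.

Lemma crm_massE w : cmass w = fine (mass w).
Proof. by rewrite /cmass /crm_mass crm_setT. Qed.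

Lemma crm_mass_ge0 w : (0 <= cmass w)%R.
Proof. by rewrite crm_massE; exact/fine_ge0/mass_ge0. Qed.

Lemma measurable_crm_mass : measurable_fun setT cmass.
Proof.
rewrite (_ : cmass = fine \o mass); last by apply/funext => w; exact: crm_massE.
by apply: measurableT_comp measurable_mass; exact: fine_measurable.
Qed.

Lemma sigma_measurable_crm_mass : measurable_fun (setT : set sigmaT) cmass.
Proof.
rewrite (_ : cmass = fine \o mass); last by apply/funext => w; exact: crm_massE.
by apply: measurableT_comp sigma_measurable_mass; exact: fine_measurable.
Qed.

Let pois n w : R := (cmass w ^+ n / n`!%:R * expR (- cmass w))%R.

Lemma pois_ge0 n w : (0 <= pois n w)%R.
Proof. by rewrite !mulr_ge0 ?expR_ge0 ?invr_ge0 ?exprn_ge0 ?crm_mass_ge0. Qed.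

Lemma measurable_pois n : measurable_fun setT (pois n).
Proof.
have mc := measurable_crm_mass.
apply: measurable_funM.
  by apply: measurable_funM => //; exact: measurable_funX.
by apply: measurableT_comp => //; exact: measurable_funN.
Qed.

Lemma size_given_points_pois n :
  is_cond_prob P <<s points_generator>> [set w | size_N w = n] (EFin \o pois n).
Proof.
have := size_given_points model n.
rewrite (_ : (fun w => poisson_law _ n) = EFin \o pois n)//.
by apply/funext => w; rewrite poisson_lawE// crm_mass_ge0.
Qed.

Lemma expN_mass_ae : {ae P, forall w, expN (mass w) = expR (- cmass w)}.
Proof.
apply: filterS mass_lty_ae => w mfin; rewrite crm_massE -expN_fin ?fineK//.
- by rewrite ge0_fin_numE// mass_ge0.
- exact/fine_ge0/mass_ge0.
Qed.

Lemma jump_le_mass k w : (jump k w)%:E <= mass w.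
Proof.
rewrite /mass (nneseriesD1 (n := k))//; last by move=> i _; rewrite lee_fin jump_ge0.
by rewrite leeDl// nneseries_ge0// => i _ _; rewrite lee_fin jump_ge0.
Qed.

(** The allocation law is integrated out first, then the law of the size: the denominators m^n of
    the assignment probabilities cancel the power in (m^n / n!) e^{-m}. *)
Lemma alloc_prob n (kappa : 'I_n -> nat) :
  P [set w | size_N w = n /\ forall i : 'I_n, alloc i w = kappa i] =
  (n`!%:R^-1)%:E *
  \int[P]_w ((expN (mass w))%:E * (\prod_(i < n) jump (kappa i) w)%:E).
Proof.
pose q w := (\prod_(i < n) (jump (kappa i) w / cmass w))%R.
have q0 w : (0 <= q w)%R.
  by apply: prodr_ge0 => i _; rewrite divr_ge0 ?jump_ge0 ?crm_mass_ge0.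
have mq : measurable_fun (setT : set sigmaT) q.
  apply: (@measurable_prod _ sigmaT _ _ _ _ (fun i w => jump (kappa i) w / cmass w)%R).
  move=> i _; apply: measurable_funM; first exact: sigma_measurable_jump.
  exact: (@measurable_inv_ge0 _ sigmaT R cmass crm_mass_ge0
    sigma_measurable_crm_mass).
have [_ /(_ setT)] := alloc_given_points_size model kappa.
rewrite setIT => ->; last first.
  exact: (@measurableT _ (g_sigma_algebraType (sigma_points jump atom `|`
    preimage_set_system setT size_N measurable))).
(* The conditional law of the allocations is the indicator of the size event times [q], which
   depends on the points only and so is a legitimate weight for the law of the size. *)
transitivity (\int[P]_w (q w * \1_[set w | size_N w = n] w)%:E).
  apply: eq_integral => w _; rewrite indicE.
  have [Nn|Nn] := eqVneq (size_N w) n; first by rewrite mem_set ?mulr1.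
  by rewrite memNset ?mulr0//; apply/eqP.
rewrite (is_cond_prob_integral points_generator_measurable
  (size_level_measurable n) (measurable_pois n) (pois_ge0 n)
  (size_given_points_pois n) mq q0).
have mE : measurable_fun setT
    (fun w => (expN (mass w))%:E * (\prod_(i < n) jump (kappa i) w)%:E).
  apply: emeasurable_funM.
    by apply/measurable_EFinP/measurable_expN_comp; exact: measurable_mass.
  apply/measurable_EFinP.
  by apply: (@measurable_prod _ _ _ _ _ _ (fun i w => jump (kappa i) w)).
have E0 w : 0 <= (expN (mass w))%:E * (\prod_(i < n) jump (kappa i) w)%:E.
  by rewrite mule_ge0// lee_fin ?expN_ge0// prodr_ge0// => i _; rewrite jump_ge0.
have n0 : (0 <= n`!%:R^-1 :> R)%R by rewrite invr_ge0.
rewrite -ge0_integralZl_EFin//.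
have mq' : measurable_fun setT q.
  apply: (@measurable_prod _ _ _ _ _ _ (fun i w => jump (kappa i) w / cmass w)%R).
  move=> i _; apply: measurable_funM => //.
  exact: (@measurable_inv_ge0 _ T R cmass crm_mass_ge0 measurable_crm_mass).
apply: ae_eq_integral => //.
- by apply/measurable_EFinP/measurable_funM => //; exact: measurable_pois.
- exact: measurable_funeM.
apply: filterS2 mass_lty_ae expN_mass_ae => w mfin -> _.
rewrite -!EFinM; congr EFin; rewrite /pois /q.
suff <- : (\prod_(i < n) (jump (kappa i) w / cmass w) * cmass w ^+ n =
    \prod_(i < n) jump (kappa i) w)%R by ring.
have -> : (cmass w ^+ n = \prod_(i < n) cmass w)%R by rewrite prodr_const card_ord.
rewrite -big_split/=; apply: eq_bigr => i _.
(* Division by a zero mass is harmless: the mass being finite here, each jump is bounded by it and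
   is 0 as well. *)
have [c0|c0] := eqVneq (cmass w) 0%R; last by rewrite divfK.
rewrite c0 mulr0; apply/esym/eqP; rewrite eq_le jump_ge0 andbT -lee_fin.
rewrite (le_trans (jump_le_mass _ _))// -[mass w]fineK -?crm_massE ?c0//.
by rewrite ge0_fin_numE// mass_ge0.
Qed.

(** Finite sequences of naturals are countable, so the event is a countable union over the encoded
    sequences. *)
Lemma measurable_alloc_event (Q : seq nat -> Prop) n :
  measurable [set w | Q [seq alloc i w | i <- iota 0 n]].
Proof.
pose s w := [seq alloc i w | i <- iota 0 n].
pose F k := if unpickle k is Some t then [set w | s w = t /\ Q t] else set0.
rewrite (_ : mkset _ = \bigcup_k F k); last first.
  apply/seteqP; split => [w Qw|w [k _]].
    by exists (pickle (s w)) => //; rewrite /F pickleK.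
  by rewrite /F; case: unpickle => // t [<-].
apply: bigcupT_measurable => k; rewrite /F; case: unpickle => [t|//].
have [Qt|nQ] := pselect (Q t); last first.
  by rewrite (_ : mkset _ = set0)// -subset0 => w [].
have [tn|tn] := eqVneq (size t) n; last first.
  rewrite (_ : mkset _ = set0)// -subset0 => w [st _]; move/eqP: tn; apply.
  by rewrite -st size_map size_iota.
rewrite (_ : mkset _ = \bigcap_(i in [set: 'I_n]) [set w | alloc i w = nth 0%N t i]).
  by apply: fin_bigcap_measurable => // i _; exact: alloc_level_measurable.
apply/seteqP; split => [w [<- _] i _ /=|w H /=].
  by rewrite (nth_map 0%N) ?size_iota// nth_iota.
split=> //; apply: (@eq_from_nth _ 0%N); first by rewrite size_map size_iota.
move=> i; rewrite size_map size_iota => ilt.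
by rewrite (nth_map 0%N) ?size_iota// nth_iota//; exact: (H (Ordinal ilt) I).
Qed.

(* The samples of size [size z] with labels [z] whose first [size ks] clusters
   sit at the atoms of indices [ks]. *)
Let cluster_event (z ks : seq nat) : set T :=
  [set w | size_N w = size z] `&`
  [set w | (fun s => labels s = z /\ forall j, (j < size ks)%N ->
                nth 0%N s (index j.+1 z) = nth 0%N ks j)
             [seq alloc i w | i <- iota 0 (size z)]].

Let cluster_sizes (z : seq nat) : seq nat :=
  [seq count_mem j z | j <- iota 1 (num_clusters z)].

(** Induction on the number [m] of clusters not yet placed. Summing over the atom of the next
    cluster reproduces the recursion of [distinct_sum]; with [ks] empty, the expectation to which
    the Palm formula applies remains. *)
Lemma cluster_event_prob z ks m : labels z = z -> uniq ks ->
  (size ks + m = num_clusters z)%N ->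
  P (cluster_event z ks) = ((size z)`!%:R^-1)%:E *
  \int[P]_w ((expN (mass w))%:E *
    ((\prod_(0 <= j < size ks)
        jump (nth 0%N ks j) w ^+ nth 0%N (cluster_sizes z) j)%:E *
     distinct_sum (fun k => jump k w) (drop (size ks) (cluster_sizes z)) ks)).
Proof.
move=> zz; elim: m ks => [|m IH] ks uks.
  rewrite addn0 => ksl; rewrite drop_oversize ?size_map ?size_iota ?ksl//=.
  (* With all clusters placed, [labels_recover] leaves a single allocation. *)
  rewrite (_ : cluster_event z ks = [set w | size_N w = size z /\
      forall i : 'I_(size z), alloc i w = nth 0%N ks (nth 0%N z i).-1]).
    rewrite alloc_prob; congr (_ * _); apply: eq_integral => w _.
    rewrite mule1; congr (_ * _%:E).
    rewrite -(big_mkord xpredT (fun i => jump (nth 0%N ks (nth 0%N z i).-1) w)).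
    rewrite -(big_nth 0%N xpredT (fun x => jump (nth 0%N ks x.-1) w)).
    rewrite prod_labels//; apply: eq_big_nat => j /andP[_ jl].
    by rewrite (nth_map 0%N) ?size_iota// nth_iota.
  have szs w : size [seq alloc i w | i <- iota 0 (size z)] = size z.
    by rewrite size_map size_iota.
  have nths w i : (i < size z)%N ->
      nth 0%N [seq alloc i w | i <- iota 0 (size z)] i = alloc i w.
    by move=> iz; rewrite (nth_map 0%N) ?size_iota// nth_iota.
  apply/seteqP; split => w [Nz H]; split => //.
    have [/(_ H) sE _ i] := labels_recover zz (szs w) uks ksl.
    have := congr1 (fun s => nth 0%N s i) sE.
    by rewrite nths// (nth_map 0%N).
  have [_] := labels_recover zz (szs w) uks ksl.
  apply; apply: (@eq_from_nth _ 0%N); first by rewrite !size_map size_iota.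
  move=> i; rewrite size_map size_iota => iz.
  by rewrite nths// (nth_map 0%N)// (H (Ordinal iz)).
move=> ksm.
have ksl : (size ks < num_clusters z)%N by rewrite -ksm addnS ltnS leq_addr.
have kz : (size ks).+1 \in z by rewrite mem_labels.
have cE : cluster_event z ks = \bigcup_k cluster_event z (rcons ks k).
  apply/seteqP; split => [w [Nz [lz H]]|w [k _ [Nz [lz H]]]].
    exists (nth 0%N [seq alloc i w | i <- iota 0 (size z)] (index (size ks).+1 z)) => //.
    split => //; split => // j; rewrite size_rcons ltnS leq_eqVlt nth_rcons.
    by move=> /predU1P[->|jk]; [rewrite ltnn eqxx|rewrite jk; exact: H].
  split => //; split => // j jk; rewrite H ?size_rcons ?ltnS ?(ltnW jk)//.
  by rewrite nth_rcons jk.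
have tE : trivIset setT (fun k => cluster_event z (rcons ks k)).
  apply/trivIsetP => k k' _ _ kk'; apply/seteqP; split => // w [[_ [_ H]] [_ [_ H']]].
  have := H (size ks); have := H' (size ks); rewrite !size_rcons ltnSn.
  rewrite !nth_rcons ltnn eqxx => -> // /(_ isT) k'k.
  by rewrite k'k eqxx in kk'.
(* Different clusters sit at different indices, so a used index contributes nothing; this yields the
   condition [k \notin u] of [distinct_sum]. *)
have c0 k : k \in ks -> cluster_event z (rcons ks k) = set0.
  move=> kks; rewrite -subset0 => w [_ [lz H]].
  have ik : (index k ks < size ks)%N by rewrite index_mem.
  have := H (index k ks); have := H (size ks).
  rewrite size_rcons ltnSn ltnS (ltnW ik) !nth_rcons ltnn eqxx ik.
  rewrite nth_index// => /(_ isT) H1 /(_ isT) H2.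
  have ki : index k ks = size ks.
    apply: (labels_distinct lz) => //; last by rewrite H1 H2.
    by rewrite mem_labels//= (ltn_trans ik).
  by rewrite ki ltnn in ik.
have mc k : measurable (cluster_event z (rcons ks k)).
  apply: measurableI; first exact: size_level_measurable.
  exact: (measurable_alloc_event (fun s => labels s = z /\
    forall j, (j < size (rcons ks k))%N ->
      nth 0%N s (index j.+1 z) = nth 0%N (rcons ks k) j) (size z)).
rewrite cE measure_bigcup//= (eq_eseriesl (Q := xpredT)); last first.
  by move=> k; rewrite in_setT.
have drE : drop (size ks) (cluster_sizes z) =
    nth 0%N (cluster_sizes z) (size ks) :: drop (size ks).+1 (cluster_sizes z).
  by rewrite -drop_nth// size_map size_iota.
pose I k := \int[P]_w ((expN (mass w))%:E *
    ((\prod_(0 <= j < size (rcons ks k))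
        jump (nth 0%N (rcons ks k) j) w ^+ nth 0%N (cluster_sizes z) j)%:E *
     distinct_sum (fun k => jump k w)
       (drop (size (rcons ks k)) (cluster_sizes z)) (rcons ks k))).
transitivity (\sum_(0 <= k <oo) (((size z)`!%:R^-1)%:E *
    (if k \notin ks then I k else 0))).
  apply: eq_eseriesr => k _; case: ifPn => [kks|/negPn kks]; last first.
    by rewrite mule0 c0// measure0.
  by rewrite IH ?rcons_uniq ?kks// size_rcons addSnnS.
have d0 w es u : 0 <= distinct_sum (fun k => jump k w) es u.
  by apply: distinct_sum_ge0 => k; exact: jump_ge0.
have p0 u w : 0 <= (\prod_(0 <= j < size u)
    jump (nth 0%N u j) w ^+ nth 0%N (cluster_sizes z) j)%:E.
  by rewrite lee_fin; apply: prodr_ge0 => j _; rewrite exprn_ge0.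
have e0 w : 0 <= (expN (mass w))%:E by rewrite lee_fin expN_ge0.
have mI u es : measurable_fun setT (fun w => (expN (mass w))%:E *
    ((\prod_(0 <= j < size u)
        jump (nth 0%N u j) w ^+ nth 0%N (cluster_sizes z) j)%:E *
     distinct_sum (fun k => jump k w) es u)).
  apply: emeasurable_funM.
    by apply/measurable_EFinP/measurable_expN_comp; exact: measurable_mass.
  apply: emeasurable_funM; last exact: measurable_distinct_sum.
  apply/measurable_EFinP; apply: (@measurable_prod _ _ _ _ _ _
    (fun j w => jump (nth 0%N u j) w ^+ nth 0%N (cluster_sizes z) j)%R) => j _.
  exact: measurable_funX.
have I0 k : 0 <= (if k \notin ks then I k else 0).
  by case: ifP => // _; apply: integral_ge0 => w _; rewrite !mule_ge0.
rewrite nneseriesZl//; congr (_ * _).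
rewrite -eseries_mkcond.
rewrite drE /=.
pose F k w := if k \notin ks then (expN (mass w))%:E *
    ((\prod_(0 <= j < size (rcons ks k))
        jump (nth 0%N (rcons ks k) j) w ^+ nth 0%N (cluster_sizes z) j)%:E *
     distinct_sum (fun k => jump k w)
       (drop (size (rcons ks k)) (cluster_sizes z)) (rcons ks k)) else 0.
have mF k : measurable_fun setT (F k) by rewrite /F; case: (k \notin ks).
have F0 k w : setT w -> 0 <= F k w.
  by move=> _; rewrite /F; case: (k \notin ks); rewrite ?mule_ge0.
transitivity (\int[P]_w \sum_(0 <= k <oo) F k w).
  rewrite (integral_nneseries P measurableT mF F0).
  rewrite eseries_mkcond; apply: eq_eseriesr => k _; rewrite /F.
  by case: (k \notin ks) => //; rewrite integral0.
apply: eq_integral => w _; rewrite /F.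
rewrite -eseries_mkcond -!ge0_nneseriesZl//; last 2 first.
- by move=> k; rewrite !mule_ge0// lee_fin exprn_ge0.
- by move=> k; rewrite !mule_ge0// lee_fin exprn_ge0.
apply: eq_eseriesr => k kks; congr (_ * _).
rewrite size_rcons big_nat_recr//= nth_rcons ltnn eqxx EFinM -muleA.
congr (_%:E * _); apply: eq_big_nat => j /andP[_ jk].
by rewrite nth_rcons jk.
Qed.

Let gamma0 := fine (G0 [set: borel_space Omega]).

Lemma joint_probE z : labels z = z ->
  joint_prob size_N alloc z (size z) =
  (expR (- (gamma0 * laplace_exponent rho (@pospow R 1))) / (size z)`!%:R *
    \prod_(j <- iota 1 (num_clusters z))
      (gamma0 * tilted_moment rho (count_mem j z) (@pospow R 1)))%:E.
Proof.
move=> zz; rewrite /joint_prob.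
rewrite (_ : _ `&` _ = cluster_event z [::]); last first.
  by apply/seteqP; split => [w [lz Nz]|w [Nz [lz _]]]; split.
have sizes0 : all (leq 1) (cluster_sizes z).
  apply/allP => a /mapP[j]; rewrite mem_iota add1n ltnS => jl ->.
  by rewrite -has_count has_pred1 mem_labels.
rewrite (@cluster_event_prob z [::] (num_clusters z))//= drop0.
under eq_integral do rewrite big_nil mul1e massE.
rewrite (palm_formula jump_ge0 points_poisson admissible_pospow1 sizes0).
by rewrite big_map -EFinM mulrA [(_^-1 * _)%R]mulrC.
Qed.

(** A zero integral of a density that is positive on ]0, +oo[ would make this interval null for
    [rho]. *)
Lemma tilted_moment_gt0 a : (0 < a)%N -> rho `]0%R, +oo[%classic != 0 ->
  (0 < tilted_moment rho a (@pospow R 1))%R.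
Proof.
move=> a0 rho0; rewrite lt_def tilted_moment_ge0 andbT; apply: contra rho0 => /eqP t0.
have := tilted_moment_pospow1 a0; rewrite t0 => /esym I0.
pose D : set R := `]0%R, +oo[%classic.
have Dgt0 s : D s -> (0 < s)%R by rewrite /D/= in_itv/= andbT.
have mD : measurable D by exact: measurable_itv.
have mf : measurable_fun D (fun s : R => (s ^+ a * expR (- s))%:E).
  apply/measurable_EFinP/measurable_funM; first exact: measurable_funX.
  by apply: measurableT_comp => //; exact: measurable_funN.
have : ae_eq rho D (fun s : R => (s ^+ a * expR (- s))%:E) (cst 0).
  apply/(ae_eq_integral_abs rho mD mf); rewrite -[RHS]I0; apply: eq_integral => s.
  rewrite inE => /Dgt0 s0.
  by rewrite gee0_abs// lee_fin mulr_ge0 ?expR_ge0 ?exprn_ge0// ltW.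
move=> [N [mN N0 sub]]; rewrite -measure_le0 -N0; apply: le_measure; rewrite ?inE//.
move=> s Ds; apply: sub => /= /(_ Ds) [] /eqP.
by rewrite mulf_eq0 expf_eq0 (gt_eqF (Dgt0 _ Ds)) andbF/= gt_eqF ?expR_gt0.
Qed.

Lemma size_pmf_cond n : size_pmf size_N n = \int[P]_w (pois n w)%:E.
Proof.
have [_ /(_ setT)] := size_given_points_pois n; rewrite setIT; apply.
exact: (@measurableT _ sigmaT).
Qed.

Lemma size_pmf_fin n : size_pmf size_N n \is a fin_num.
Proof. by apply: fin_num_measure; exact: size_level_measurable. Qed.

Lemma sum_pois_le1 (t : R) K w : (`|t| <= 1)%R ->
  (`|\sum_(0 <= n < K) t ^+ n * pois n w| <= 1)%R.
Proof.
move=> t1; have m0 := crm_mass_ge0 w.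
apply: le_trans (ler_norm_sum _ _ _) _.
apply: (@le_trans _ _ (\sum_(0 <= n < K) cmass w ^+ n / n`!%:R * expR (- cmass w))%R).
  apply: ler_sum => n _; rewrite normrM normrX [X in (_ * X)%R]ger0_norm ?pois_ge0//.
  by rewrite ler_piMl ?pois_ge0// exprn_ile1.
rewrite -mulr_suml -[leRHS](expRxMexpNx_1 (cmass w)) ler_wpM2r ?expR_ge0//.
rewrite -lee_fin -nneseries_exp_coeff// -sumEFin.
by apply: nneseries_lim_ge => n _ _; rewrite lee_fin divr_ge0// exprn_ge0.
Qed.

(** The truncated sum of t^n over the events N = n is t^N on N < K and 0 elsewhere. Since [t] may be
    negative, the limit is taken by domination, with bound 1. *)
Lemma size_pgf_cvg (t : R) : (`|t| <= 1)%R ->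
  (\sum_(0 <= n < K) t ^+ n * fine (size_pmf size_N n))%:E @[K --> \oo]
    --> size_pgf size_N t.
Proof.
move=> t1.
have -> : size_pgf size_N t = \int[P]_w (t ^+ size_N w)%:E by rewrite /size_pgf unlock.
pose g K w := \sum_(0 <= n < K) (t ^+ n * \1_[set w | size_N w = n] w)%:E.
have mg n : measurable_fun setT (fun w => (t ^+ n * \1_[set w | size_N w = n] w)%:E).
  apply/measurable_EFinP/measurable_funM => //.
  by apply: measurable_indic; exact: size_level_measurable.
have gE K w : g K w = ((size_N w < K)%N%:R * t ^+ size_N w)%:E.
  rewrite /g sumEFin; congr EFin; have [NK|NK] := ltnP.
    rewrite mul1r (bigD1_seq (size_N w)) ?iota_uniq ?mem_index_iota//=.
    rewrite indicE mem_set// mulr1 big1 ?addr0// => n nN.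
    by rewrite indicE memNset ?mulr0// => /= Nn; rewrite Nn eqxx in nN.
  rewrite mul0r big_nat big1// => n /andP[_ nK].
  rewrite indicE memNset ?mulr0// => /= Nn; move: nK.
  by rewrite -Nn ltnNge NK.
have le1 K w : `|g K w| <= 1.
  rewrite gE lee_fin normrM ger0_norm// normrX.
  case: (_ < _)%N; last by rewrite mul0r.
  by rewrite mul1r exprn_ile1.
have gcvg w : g K w @[K --> \oo] --> (t ^+ size_N w)%:E.
  apply: cvg_near_cst; exists (size_N w).+1 => // K /= NK.
  by rewrite gE NK mul1r.
have mt : measurable_fun setT (fun w => (t ^+ size_N w)%:E).
  apply: (@emeasurable_fun_cvg _ _ _ setT g) => [K|w _]; last exact: gcvg.
  exact: emeasurable_sum.
have [] // := @dominated_convergence _ _ _ P setT measurableT g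
  (fun w => (t ^+ size_N w)%:E) (cst 1).
- by move=> K; exact: emeasurable_sum.
- by apply: aeW => w _; exact: gcvg.
- exact: finite_measure_integrable_cst.
- by apply: aeW => w K _; exact: le1.
move=> _ _; apply: cvg_trans; apply: near_eq_cvg; apply: nearW => K /=.
have iI n : P.-integrable setT (fun w => (\1_[set w | size_N w = n] w : R)%:E).
  have mA := size_level_measurable n; apply/integrableP; split.
    by apply/measurable_EFinP/measurable_indic.
  rewrite (eq_integral (fun w => (\1_[set w | size_N w = n] w : R)%:E)).
    by rewrite integral_indic// setIT ltey_eq size_pmf_fin.
  by move=> w _; rewrite gee0_abs// lee_fin.
have itn n : P.-integrable setT
    (fun w => (t ^+ n * \1_[set w | size_N w = n] w)%:E).
  by under eq_fun do rewrite EFinM; apply: integrableZl.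
rewrite /g integral_sum// -sumEFin; apply: eq_bigr => n _.
under eq_integral do rewrite EFinM.
rewrite integralZl// integral_indic ?setIT//; last exact: size_level_measurable.
by rewrite EFinM fineK ?size_pmf_fin.
Qed.

Lemma sum_pois_cvg (t : R) w :
  (\sum_(0 <= n < K) t ^+ n * pois n w)%R @[K --> \oo] -->
  expR (- ((1 - t) * cmass w)).
Proof.
have -> : (expR (- ((1 - t) * cmass w)) = expR (t * cmass w) * expR (- cmass w))%R.
  by rewrite -expRD; congr expR; ring.
have cs : series (exp_coeff (t * cmass w)%R) n @[n --> \oo] --> expR (t * cmass w).
  exact: is_cvg_series_exp_coeff.
have : (series (exp_coeff (t * cmass w)) n * expR (- cmass w))%R @[n --> \oo]
  --> (expR (t * cmass w) * expR (- cmass w))%R by exact: cvgMl.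
apply: cvg_trans.
apply: near_eq_cvg; apply: nearW => K; rewrite /series/= mulr_suml.
by apply: eq_bigr => n _; rewrite /pois /exp_coeff/= exprMn; ring.
Qed.

(** The same partial sums converge to the generating function and, through the conditional Poisson
    law, to E e^{-(1 - t) m}, with m = [crm_mass]. Uniqueness of limits and the Laplace functional
    at (1 - t) s conclude. *)
Lemma size_pgfE (t : R) : (`|t| <= 1)%R ->
  size_pgf size_N t = (expN (G0 [set: borel_space Omega] *
    \int[rho]_(s in `]0%R, +oo[) (1 - expR (- ((1 - t) * s)))%:E))%:E.
Proof.
move=> t1; have t0 : (0 <= 1 - t)%R by rewrite subr_ge0 (le_trans (ler_norm t)).
have mt : measurable_fun setT (fun w => (expR (- ((1 - t) * cmass w)))%:E).
  apply/measurable_EFinP; apply: measurableT_comp => //; apply: measurable_funN.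
  by apply: measurable_funM => //; exact: measurable_crm_mass.
have mpn n : measurable_fun setT (fun w => (t ^+ n * pois n w)%:E).
  by apply/measurable_EFinP/measurable_funM => //; exact: measurable_pois.
have ipn n : P.-integrable setT (fun w => (pois n w)%:E).
  apply/integrableP; split; first by apply/measurable_EFinP; exact: measurable_pois.
  under eq_integral do rewrite gee0_abs ?lee_fin ?pois_ge0//.
  by rewrite -size_pmf_cond -ge0_fin_numE ?size_pmf_fin.
have cv : (\sum_(0 <= n < K) t ^+ n * fine (size_pmf size_N n))%:E @[K --> \oo]
    --> \int[P]_w (expR (- ((1 - t) * cmass w)))%:E.
  have [] // := @dominated_convergence _ _ _ P setT measurableT
    (fun K w => \sum_(0 <= n < K) (t ^+ n * pois n w)%:E)
    (fun w => (expR (- ((1 - t) * cmass w)))%:E) (cst 1).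
  - by move=> K; exact: emeasurable_sum.
  - apply: aeW => w _; under eq_fun do rewrite sumEFin.
    by apply/cvg_EFin; [exact: nearW|exact: sum_pois_cvg].
  - exact: finite_measure_integrable_cst.
  - by apply: aeW => w K _; rewrite sumEFin lee_fin sum_pois_le1.
  move=> _ _; apply: cvg_trans; apply: near_eq_cvg; apply: nearW => K /=.
  rewrite integral_sum//; last first.
    by move=> n; under eq_fun do rewrite EFinM; apply: integrableZl.
  rewrite -sumEFin; apply: eq_bigr => n _; under eq_integral do rewrite EFinM.
  by rewrite integralZl// -size_pmf_cond EFinM fineK ?size_pmf_fin.
rewrite -(cvg_lim (@ereal_hausdorff R) (size_pgf_cvg t1)).
rewrite (cvg_lim (@ereal_hausdorff R) cv).
have -> : \int[rho]_(s in `]0%R, +oo[) (1 - expR (- ((1 - t) * s)))%:E =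
    \int[rho]_s (1 - expR (- ((1 - t) * pospow 1 s)))%:E.
  rewrite (integral_pospow (psi := fun s => 1 - expR (- ((1 - t) * s)))%R)//.
  by rewrite mulr0 oppr0 expR0 subrr.
have p0 s : (0 <= (1 - t) * pospow 1 s)%R by rewrite mulr_ge0 ?pospow_ge0.
have mp : measurable_fun setT (fun s => (1 - t) * pospow 1 s)%R.
  by apply: measurable_funM => //; exact: measurable_pospow.
rewrite -(laplace_functional jump_ge0 points_poisson mp p0); last first.
  by rewrite pospow_le0// mulr0.
apply: ae_eq_integral => //.
  by apply/measurable_EFinP/measurable_expN_comp; exact: (measurable_nneseries_jump jump mp p0).
apply: filterS mass_lty_ae => w mfin _; congr EFin.
under eq_eseriesr do rewrite EFinM.
rewrite nneseriesZl; last by move=> k _; rewrite lee_fin pospow_ge0.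
rewrite -massE -[mass w]fineK ?ge0_fin_numE ?mass_ge0// -crm_massE.
by rewrite -EFinM expN_fin// mulr_ge0// crm_mass_ge0.
Qed.

End model_theory.

(** * Iterated derivatives of a power series at 0 *)

Section power_series.
Context (R : realType).
Implicit Types (c : nat -> R) (t u v : R).

(** This bounds the factor n + 1 created by differentiation: it is absorbed by enlarging the radius
    from [v] to [u], at the cost of the constant 1 / (u - v). *)
Lemma le_natr_mul_expr u v n : (0 <= v <= u)%R ->
  (n.+1%:R * (u - v) * v ^+ n <= u ^+ n.+1)%R.
Proof.
move=> /andP[v0 vu]; have u0 := le_trans v0 vu; elim: n => [|n IH].
  by rewrite expr0 expr1 mulr1 mul1r; lra.
have vu1 : (v ^+ n.+1 <= u ^+ n.+1)%R by rewrite lerXn2r ?nnegrE.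
have := ler_wpM2l v0 IH; have uv : (0 <= u - v)%R by rewrite subr_ge0.
have := ler_wpM2l uv vu1; rewrite -natr1 !exprS.
move: (v ^+ n)%R (u ^+ n)%R (n.+1%:R : R)%R => a b k; lra.
Qed.

Lemma is_cvg_pseries_diffs c K t : cvgn (pseries c K) -> (`|t| < `|K|)%R ->
  cvgn (pseries (pseries_diffs c) t).
Proof.
(* The midpoint of |t| and |K|: absolute convergence holds at [u], and there is room left above
   |t|. *)
move=> cK tK; pose u := ((`|t| + `|K|) / 2)%R.
have tu : (`|t| < u)%R by rewrite /u; lra.
have u0 : (0 <= u)%R by rewrite (le_trans _ (ltW tu)).
have uK : (`|u| < `|K|)%R by rewrite ger0_norm// /u; lra.
have cu := is_cvg_pseries_inside_norm cK uK.
apply: normed_cvg.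
have du : (0 < u - `|t|)%R by rewrite subr_gt0.
apply: (@series_le_cvg _ _ (fun i => (u - `|t|)^-1 * (`|c i.+1| * u ^+ i.+1))%R).
- by move=> i /=; exact: normr_ge0.
- by move=> i; rewrite !mulr_ge0 ?invr_ge0 ?exprn_ge0// ltW.
- move=> i /=; rewrite /pseries_diffs !normrM normrX (ger0_norm (ler0n _ _)).
  have := @le_natr_mul_expr u `|t| i; rewrite normr_ge0 (ltW tu) => /(_ isT).
  move=> /(ler_wpM2l (normr_ge0 (c i.+1))); rewrite ler_pdivlMl//.
  by apply: le_trans; rewrite le_eqVlt; apply/orP; left; apply/eqP; ring.
- move: cu => /cvg_ex[l cl]; apply/cvg_ex.
  exists ((u - `|t|)^-1 * (l - `|c 0%N| * u ^+ 0))%R.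
  have cS : (\sum_(0 <= i < n.+1) `|c i| * u ^+ i)%R @[n --> \oo] --> l.
    have := cl; rewrite -(cvg_shiftS (pseries (fun i => `|c i|) u))%R.
    exact.
  have : ((u - `|t|)^-1 * ((\sum_(0 <= i < n.+1) `|c i| * u ^+ i) -
      `|c 0%N| * u ^+ 0))%R @[n --> \oo]
      --> ((u - `|t|)^-1 * (l - `|c 0%N| * u ^+ 0))%R.
    by apply: cvgMr; apply: cvgB; [exact: cS|exact: cvg_cst].
  apply: cvg_trans; apply: near_eq_cvg; apply: nearW => n.
  by rewrite big_nat_recl// addrAC subrr add0r mulr_sumr.
Qed.

Lemma pseries_at0 c : limn (pseries c 0%R) = c 0%N.
Proof.
apply: cvg_lim => //; apply: cvg_near_cst; exists 1%N => // -[//|n] _.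
rewrite /pseries /series/= big_nat_recl// expr0 mulr1 big1 ?addr0// => i _.
by rewrite expr0n mulr0.
Qed.

Lemma iter_pseries_diffs_at0 c n :
  iter n (@pseries_diffs R) c 0%N = (n`!%:R * c n)%R.
Proof.
(* The induction needs every coefficient of the derived series; at [m = 0] the falling factorial
   becomes n!. *)
have iterE m : iter n (@pseries_diffs R) c m = (((m + n) ^_ n)%:R * c (m + n)%N)%R.
  elim: n m => [|n IH] m; first by rewrite addn0 ffactn0 mul1r.
  rewrite iterS /pseries_diffs IH addSnnS mulrA -natrM; congr (_%:R * _)%R.
  by rewrite ffactnSr mulnC; congr muln; rewrite -addSnnS addnK.
by rewrite iterE add0n ffactnn.
Qed.

Variables (c : nat -> R) (F : R -> R).
Hypothesis cF : forall t, (`|t| < 1)%R -> pseries c t n @[n --> \oo] --> F t.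

Lemma is_cvg_iter_diffs n t : (`|t| < 1)%R ->
  cvgn (pseries (iter n (@pseries_diffs R) c) t).
Proof.
elim: n t => [|n IH] t t1; first by apply/cvg_ex; exists (F t); exact: cF.
have tn : (0 <= `|t|)%R by [].
apply: (@is_cvg_pseries_diffs _ ((`|t| + 1) / 2)%R).
  by apply: IH; rewrite ger0_norm; lra.
by rewrite [ltRHS]ger0_norm; lra.
Qed.

Lemma is_derive_iter_diffs n t : (`|t| < 1)%R ->
  is_derive t 1%R (fun x => limn (pseries (iter n (@pseries_diffs R) c) x))
    (limn (pseries (iter n.+1 (@pseries_diffs R) c) t)).
Proof.
move=> t1; have tn : (0 <= `|t|)%R by [].
have K1 : (`|(`|t| + 1) / 2 : R| < 1)%R by rewrite ger0_norm; lra.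
(* Differentiation at [t] asks for convergence of the series and of its first two derived series at
   one larger radius, here the midpoint of |t| and 1. *)
apply: (@pseries_snd_diffs _ _ ((`|t| + 1) / 2)%R); first exact: is_cvg_iter_diffs.
- by have := @is_cvg_iter_diffs n.+1 _ K1.
- by have := @is_cvg_iter_diffs n.+2 _ K1.
- by rewrite [ltRHS]ger0_norm; lra.
Qed.

Lemma near_norm_lt1 t : (`|t| < 1)%R -> \forall x \near t, (`|x| < 1 :> R)%R.
Proof.
move=> t1; have := @norm_continuous _ R t.
by move=> /cvgr_lt tH; exact: tH.
Qed.

Lemma derive1n_pseries n t : (`|t| < 1)%R ->
  derive1n n F t = limn (pseries (iter n (@pseries_diffs R) c) t).
Proof.
elim: n t => [|n IH] t t1; first by apply/esym/cvg_lim => //; exact: cF.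
rewrite derive1nS derive1E.
(* The iterated derivative of [F] is identified with a series on the open unit disc only, hence near
   [t], which suffices for the derivative. *)
rewrite (@near_eq_derive _ _ _ _
  (fun x => limn (pseries (iter n (@pseries_diffs R) c) x))).
  by have [_ ->] := @is_derive_iter_diffs n _ t1.
by apply: filterS (near_norm_lt1 t1) => x; exact: IH.
Qed.

Lemma derivable_derive1n_pseries n t : (`|t| < 1)%R ->
  derivable (derive1n n F) t 1%R.
Proof.
move=> t1; have [dt _] := @is_derive_iter_diffs n _ t1.
apply: near_eq_derivable dt.
by apply: filterS (near_norm_lt1 t1) => x /derive1n_pseries ->.
Qed.

Lemma derive1n_pseries0 n : derive1n n F 0%R = (n`!%:R * c n)%R.
Proof. by rewrite derive1n_pseries ?normr0// pseries_at0 iter_pseries_diffs_at0. Qed.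

End power_series.

(** * Total count, sign of the exponent, and the three claims *)

Lemma mixed_poisson_process_setT (R : realType) (Omega : completeMetricType R)
    d (T : measurableType d) (P : probability T R)
    (atom : nat -> {RV P >-> borel_space Omega})
    (size_N : {RV P >-> nat}) (alloc : nat -> {RV P >-> nat}) w :
  mixed_poisson_process atom size_N alloc w [set: Omega] = (size_N w)%:R%:E.
Proof.
rewrite /mixed_poisson_process.
transitivity (\sum_(0 <= k <oo)
    \sum_(i <- iota 0 (size_N w)) ((alloc i w == k)%:R%:E : \bar R)).
  apply: eq_eseriesr => k _; rewrite diracT mule1 /atom_count -sum1_count.
  by rewrite big_mkcond/= sumEFin natr_sum; congr EFin; apply: eq_bigr => i _; case: eqP.
rewrite nneseries_sum; last by move=> i k _; rewrite lee_fin ler0n.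
rewrite (eq_bigr (fun=> 1)); last first.
  move=> i _; rewrite (nneseriesD1 (n := alloc i w))//.
  by rewrite eqxx eseries0 ?adde0// => k _ /andP[_]; rewrite eq_sym => /negPf ->.
by rewrite sumEFin big_const_seq count_predT size_iota iter_addr_0.
Qed.

Lemma integral_expR_sub1 (R : realType) (mu : {measure set R -> \bar R})
    (gamma t : R) : (t <= 1)%R ->
  gamma%:E * \int[mu]_(s in `]0%R, +oo[) (expR (- ((1 - t) * s)) - 1)%:E =
  - (gamma%:E * \int[mu]_(s in `]0%R, +oo[) (1 - expR (- ((1 - t) * s)))%:E).
Proof.
move=> t1; rewrite -muleN -integral_ge0N; last first.
  move=> s /=; rewrite in_itv/= andbT => s0.
  by rewrite lee_fin one_sub_expRN_ge0// mulr_ge0 ?subr_ge0// ltW.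
by congr (_ * _); apply: eq_integral => s _; rewrite -EFinN opprB.
Qed.

Unset Implicit Arguments.
Set Strict Implicit.
Set Printing Implicit Defensive.

Theorem corollary2 (R : realType) (Omega : completeMetricType R)
    (Omega_separable : separable_space Omega)
    (G0 : {finite_measure set (borel_space Omega) -> \bar R})
    (G0_gt0 : 0 < G0 [set: Omega])
    (rho : {measure set R -> \bar R})
    (rho_carrier : rho `]-oo, 0%R]%classic = 0)
    (rho_neq0 : rho `]0%R, +oo[%classic != 0)
    (rho_int : \int[rho]_(s in `]0%R, +oo[) (1 - expR (- s))%:E < +oo)
    (d : measure_display) (T : measurableType d) (P : probability T R)
    (jump : nat -> {RV P >-> R})
    (atom : nat -> {RV P >-> borel_space Omega})
    (size_N : {RV P >-> nat}) (alloc : nat -> {RV P >-> nat})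
    (model : crm_mixed_poisson_model jump atom size_N alloc G0 rho) :
  let gamma0 : R := fine (G0 [set: Omega]) in
  [/\ (forall (n : nat) (z : n.-tuple nat), labels z = z ->
        let l := num_clusters z in
        joint_prob size_N alloc z n =
          (gamma0 ^+ l / n`!%:R)%:E *
          expeR (gamma0%:E *
                 \int[rho]_(s in `]0%R, +oo[) (expR (- s) - 1)%:E) *
          \prod_(1 <= k < l.+1)
            \int[rho]_(s in `]0%R, +oo[)
              (s ^+ (\sum_(i < n) (tnth z i == k))%N * expR (- s))%:E),
      [/\ (forall w, mixed_poisson_process atom size_N alloc w [set: Omega] =
                     (size_N w)%:R%:E),
          (forall t : R, (`|t| <= 1)%R ->
            size_pgf size_N t =
              expeR (gamma0%:E *
                     \int[rho]_(s in `]0%R, +oo[)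
                       (expR (- ((1 - t) * s)) - 1)%:E)),
          (forall n : nat,
            derivable (derive1n n (fun t : R => fine (size_pgf size_N t)))
              0%R 1%R) &
          (forall n : nat,
            size_pmf size_N n =
              (derive1n n (fun t : R => fine (size_pgf size_N t)) 0%R / n`!%:R)%:E)] &
      (forall (n : nat) (z : n.-tuple nat), labels z = z ->
        0 < size_pmf size_N n /\
        cond_label_prob size_N alloc z n =
          joint_prob size_N alloc z n / size_pmf size_N n)].

Proof.
move=> gamma0; have G0E : G0 [set: borel_space Omega] = gamma0%:E.
  by rewrite fineK// fin_num_measure.
have gamma0_gt0 : (0 < gamma0)%R by rewrite -lte_fin -G0E.
have jointE (n : nat) (z : n.-tuple nat) : labels z = z ->
    joint_prob size_N alloc z n =
    (expR (- (gamma0 * laplace_exponent rho (@pospow R 1))) / n`!%:R *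
      \prod_(j <- iota 1 (num_clusters z))
        (gamma0 * tilted_moment rho (count_mem j z) (@pospow R 1)))%:E.
  by move=> zz; have := joint_probE rho_int model zz; rewrite size_tuple.
have pgfE (t : R) : (`|t| <= 1)%R -> size_pgf size_N t =
    expeR (gamma0%:E *
      \int[rho]_(s in `]0%R, +oo[) (expR (- ((1 - t) * s)) - 1)%:E).
  move=> t1; have t1' : (t <= 1)%R by rewrite (le_trans (ler_norm t)).
  rewrite (size_pgfE rho_int model t1) G0E integral_expR_sub1// expNE//.
  rewrite mule_ge0 ?lee_fin ?(ltW gamma0_gt0)//; apply: integral_ge0 => s /=.
  rewrite in_itv/= andbT => s0.
  by rewrite lee_fin one_sub_expRN_ge0// mulr_ge0 ?subr_ge0// ltW.
have pgf_series (t : R) : (`|t| < 1)%R ->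
    pseries (fun n => fine (size_pmf size_N n)) t n @[n --> \oo] -->
    fine (size_pgf size_N t).
  move=> t1; have := @size_pgf_cvg _ _ _ P size_N t (ltW t1).
  have : size_pgf size_N t \is a fin_num by rewrite (size_pgfE rho_int model (ltW t1)).
  move=> /fineK <- /fine_cvg; apply: cvg_trans; apply: near_eq_cvg.
  by apply: nearW => K /=; apply: eq_bigr => n _; rewrite mulrC.
have countE n (z : n.-tuple nat) k : (\sum_(i < n) (tnth z i == k))%N = count_mem k z.
  rewrite -sum1_count -(big_tuple _ _ z xpredT (fun x => nat_of_bool (x == k))).
  by rewrite [RHS]big_mkcond/=; apply: eq_bigr => i _; case: eqP.
split.
- move=> n z zz l; rewrite jointE// -/l.
  (* The exponent of the joint law is that of the generating function at [t = 0]. *)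
  have := @integral_expR_sub1 R rho gamma0 0%R ler01.
  under eq_integral do rewrite subr0 mul1r.
  under [X in _ = - (_ * X) -> _]eq_integral do rewrite subr0 mul1r.
  move=> ->.
  have -> : \int[rho]_(s in `]0%R, +oo[) (1 - expR (- s))%:E =
      (laplace_exponent rho (@pospow R 1))%:E.
    rewrite (laplace_exponentE (admissible_pospow1 rho_int)).
    by rewrite (@integral_pospow _ _ (fun s => 1 - expR (- s))%R)// oppr0 expR0 subrr.
  have -> : expeR (- (gamma0%:E * (laplace_exponent rho (@pospow R 1))%:E)) =
      (expR (- (gamma0 * laplace_exponent rho (@pospow R 1))))%:E by [].
  rewrite /index_iota subn1 /=.
  rewrite (eq_big_seq (fun k => (tilted_moment rho (count_mem k z) (@pospow R 1))%:E)).
    rewrite prodEFin -!EFinM; congr EFin; rewrite big_split/= big_const_seq.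
    rewrite count_predT size_iota iter_mulr_1.
    by ring.
  (* Each label from 1 to [l] occurs in [z], so its cluster size is positive, as the moment formula
     requires. *)
  move=> k; rewrite mem_iota add1n ltnS => kl; rewrite countE.
  by rewrite -(tilted_moment_pospow1 rho_int)// -has_count has_pred1 mem_labels.
- split.
  + exact: mixed_poisson_process_setT.
  + exact: pgfE.
  + by move=> n; apply: (derivable_derive1n_pseries pgf_series); rewrite normr0.
  + move=> n; rewrite (derive1n_pseries0 pgf_series) mulrAC divff ?mul1r ?fineK//.
    exact: size_pmf_fin.
(* The quotient is the definition of the conditional probability; the content is that its
   denominator is positive. It dominates the joint probability of [z], a product of positive
   factors. *)
- move=> n z zz; split=> //; apply: (@lt_le_trans _ _ (joint_prob size_N alloc z n)).
    rewrite jointE// lte_fin mulr_gt0 ?divr_gt0 ?expR_gt0 ?ltr0n ?fact_gt0//.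
    rewrite big_seq; apply: prodr_gt0 => k; rewrite mem_iota add1n ltnS => kl.
    rewrite mulr_gt0// (tilted_moment_gt0 rho_int)//.
    by rewrite -has_count has_pred1 mem_labels.
  apply: le_measure; rewrite ?inE; [|exact: size_level_measurable|by move=> w []].
  apply: measurableI; last exact: size_level_measurable.
  exact: (measurable_alloc_event alloc (fun s => labels s = z)).
Qed.
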